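(* Let $\ell\in\tfrac12\mathbb N$, $\nu\ge1$, and let $T^{(\nu)}$ be the diagonal matrix with $T^{(\nu)}_{i,i}=\binom{2\ell}{i}\frac{(\nu)_i}{(\nu+2\ell-i)_i}$ for $i=0,\dots,\lfloor\ell\rfloor$ and $T^{(\nu)}_{i,i}=T^{(\nu)}_{2\ell-i,2\ell-i}$. Then the pair $$W^{(\nu)}(y)=(1-y)^{\nu-1/2}y^{\nu-1/2}\,\Psi_0(y)\,T^{(\nu)}\,\Psi_0(y)^*,$$ $$D^{(\nu)}=y(1-y)\partial_y^2+\partial_y\big(C+\nu-1-y(U+2(\nu-1))\big)-\big(V+(\nu-1)U+(\nu-1)(\nu-2)\big)$$ is a matrix-valued classical pair on $(0,1)$.
   Context: Matrices have size $2\ell+1$, indices $0,\dots,2\ell$; $E_{i,j}$ are matrix units; scalars stand for multiples of the identity; $(a)_i=a(a+1)\cdots(a+i-1)$. $$C=-\sum_{i=0}^{2\ell-1}\frac{2\ell-i}{2}E_{i,i+1}+\sum_{i=0}^{2\ell}\frac{2\ell+3}{2}E_{i,i}-\sum_{i=1}^{2\ell}\frac i2E_{i,i-1},\quad U=(2\ell+3)I,\quad V=-\sum_{i=0}^{2\ell}i(2\ell-i)E_{i,i}.$$ $\Psi_0(y)=\Phi_0(\arccos(1-2y))$, $y\in[0,1]$, where for $n,m\in\{0,\dots,2\ell\}$ $$(\Phi_0(t))_{n,m}=\sum_{j_1=-\frac n2}^{\frac n2}\ \sum_{j_2=-\frac{2\ell-n}{2}}^{\frac{2\ell-n}{2}}\delta_{-\ell+m,\,j_1+j_2}\binom{n}{j_1+\frac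 n2}\binom{2\ell-n}{j_2+\frac{2\ell-n}{2}}\binom{2\ell}{2\ell-m}^{-1}e^{i(j_2-j_1)t}$$ ($j_1,j_2$ in unit steps). Differential operators act from the right: for $D=\partial_y^2F_2+\partial_yF_1+F_0$, $PD=P''F_2+P'F_1+PF_0$. A matrix-valued classical pair on $(0,1)$ is a pair $(W,D)$ where $W:(0,1)\to\mathbb C^{N\times N}$ is smooth, positive definite, with finite moments, and $D=\partial_y^2F_2+\partial_yF_1+F_0$ with $F_i$ a matrix polynomial of degree at most $i$, such that $\langle PD,Q\rangle=\langle P,QD\rangle$ for all matrix polynomials $P,Q$, where $\langle P,Q\rangle=\int_0^1P(y)W(y)Q(y)^*dy$. *)

(* Defs.v *)
From HB Require Import structures.
From mathcomp Require Import all_boot all_order all_algebra.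
From mathcomp Require Import complex.
From mathcomp Require Import all_classical all_reals all_analysis.

Set Implicit Arguments.
Unset Strict Implicit.
Unset Printing Implicit Defensive.

Import Order.TTheory GRing.Theory Num.Theory.
Import numFieldNormedType.Exports.

Local Open Scope classical_set_scope.
Local Open Scope ring_scope.
Local Open Scope complex_scope.
Local Open Scope sesquilinear_scope.

Section ClassicalPairs.
Variables (R : realType) (N : nat).
(* Matrices have size N.+1, so that they form a nonzero ring and matrix
   polynomials can be taken to be polynomials with matrix coefficients. *)
Notation C := (R[i]).
Notation M := ('M[C]_N.+1).

(* The variable is real, hence evaluated at a central element. *)
Definition mxeval (P : {poly M}) (y : R) : M := P.[(y%:C)%:M].

(* dy^2 F2 + dy F1 + F0, acting from the right. *)
Record diff_op := DiffOp {
  dcoef2 : {poly M};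
  dcoef1 : {poly M};
  dcoef0 : {poly M}
}.

Definition diff_act (P : {poly M}) (D : diff_op) : {poly M} :=
  P^`(2) * dcoef2 D + P^`() * dcoef1 D + P * dcoef0 D.

Definition smooth01 (f : R -> R) : Prop :=
  forall (k : nat) (y : R), y \in `]0, 1[ -> derivable (derive1n k f) y 1.

Definition integrable01 (f : R -> R) : Prop :=
  (@lebesgue_measure R).-integrable `]0, 1[ (EFin \o f).

Definition cintegral01 (f : R -> C) : C :=
  (\int[@lebesgue_measure R]_(y in `]0, 1[) complex.Re (f y))
  +i* (\int[@lebesgue_measure R]_(y in `]0, 1[) complex.Im (f y)).

Definition mxsmooth01 (W : R -> M) : Prop :=
  forall i j : 'I_N.+1,
    smooth01 (fun y => complex.Re (W y i j)) /\ smooth01 (fun y => complex.Im (W y i j)).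

Definition mxposdef (A : M) : Prop :=
  A ^t* = A /\
  forall v : 'rV[C]_N.+1, v != 0 -> 0 < (v *m A *m v ^t*) 0 0.

Definition finite_moments01 (W : R -> M) : Prop :=
  forall (k : nat) (i j : 'I_N.+1),
    integrable01 (fun y => y ^+ k * complex.Re (W y i j)) /\
    integrable01 (fun y => y ^+ k * complex.Im (W y i j)).

Definition mxinner (W : R -> M) (P Q : {poly M}) : M :=
  \matrix_(i, j)
    cintegral01 (fun y => (mxeval P y *m W y *m (mxeval Q y) ^t*) i j).

(* Only the values of W on (0, 1) matter. *)
Record classical_pair (W : R -> M) (D : diff_op) : Prop := ClassicalPair {
  pair_smooth : mxsmooth01 W;
  pair_posdef : forall y : R, y \in `]0, 1[ -> mxposdef (W y);
  pair_moments : finite_moments01 W;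
  pair_deg2 : (size (dcoef2 D) <= 3)%N;
  pair_deg1 : (size (dcoef1 D) <= 2)%N;
  pair_deg0 : (size (dcoef0 D) <= 1)%N;
  pair_symmetric : forall P Q : {poly M},
    mxinner W (diff_act P D) Q = mxinner W P (diff_act Q D)
}.

End ClassicalPairs.

(* The half-integer l is represented by the natural number L = 2l. *)
Section Family.
Variables (R : realType) (L : nat).
Notation C := (R[i]).
Notation M := ('M[C]_L.+1).

Definition poch (a : R) (n : nat) : R := \prod_(k < n) (a + k%:R).

Definition expi (x : R) : C := cos x +i* sin x.

(* j1 = a - n/2 and j2 = b - (2l - n)/2, so the two binomial coefficients
   indexed by j1 + n/2 and j2 + (2l - n)/2 are those indexed by a and b. *)
Definition Phi0 (t : R) : M :=
  \matrix_(n < L.+1, m < L.+1)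
    \sum_(a < n.+1) \sum_(b < (L - n).+1)
      let j1 : R := a%:R - n%:R / 2 in
      let j2 : R := b%:R - (L - n)%:R / 2 in
      if - (L%:R / 2) + m%:R == j1 + j2 then
        'C(n, a)%:R * 'C(L - n, b)%:R * ('C(L, L - m)%:R)^-1
          * expi ((j2 - j1) * t)
      else 0.

Definition Psi0 (y : R) : M := Phi0 (acos (1 - 2 * y)).

Definition Cmx : M :=
  \matrix_(i < L.+1, j < L.+1)
    (- ((L%:R - i%:R) / 2) * (j == i.+1 :> nat)%:R
     + (L%:R + 3) / 2 * (j == i)%:R
     - i%:R / 2 * (i == j.+1 :> nat)%:R).

Definition Umx : M := (L%:R + 3)%:M.

Definition Vmx : M :=
  - diag_mx (\row_(i < L.+1) (i%:R * (L%:R - i%:R))).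

Definition tcoef (nu : R) (i : nat) : R :=
  'C(L, i)%:R * (poch nu i / poch (nu + L%:R - i%:R) i).

(* L./2 is the integer part of l. *)
Definition Tmx (nu : R) : M :=
  diag_mx (\row_(i < L.+1)
    (if (i <= L./2)%N then tcoef nu i else tcoef nu (L - i))%:C).

Definition Wnu (nu : R) (y : R) : M :=
  (((1 - y) `^ (nu - 1 / 2) * y `^ (nu - 1 / 2))%:C)
    *: (Psi0 y *m Tmx nu *m (Psi0 y) ^t*).

Definition Dnu (nu : R) : diff_op R L :=
  DiffOp
    ('X * (1 - 'X))
    ((Cmx + ((nu - 1)%:C)%:M)%:P - 'X * (Umx + ((2 * (nu - 1))%:C)%:M)%:P)
    (- (Vmx + (nu - 1)%:C *: Umx + (((nu - 1) * (nu - 2))%:C)%:M)%:P).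

End Family.

(* Main.v *)
(** With c = 1 - 2y, alpha = sqrt(1-y) + i sqrt(y) and beta its conjugate, row n
    of Psi_0 is read off the polynomial
    g_n = (alpha + beta X)^n (beta + alpha X)^(L-n), up to the binomials C(L,m).
    Differentiating g_n in y and in X gives, for J = (L+3) - 2C,
    H = diag(2n - L) and two bidiagonal matrices E, F,
      4 y(1-y) Psi' = (L c - J) Psi,  J Psi = Psi (E+F),
      z H Psi = Psi (E - F - c H)  with z^2 = - 4y(1-y).
    The first equation makes W solve a linear ODE, which gives smoothness and the
    first symmetry equation; since V = (H^2 - L^2)/4, the other two turn the
    second symmetry equation into an identity between E, F, H and T that amounts
    to a two-term recursion for the entries of T.  The symmetry equations imply
    that (PD)WQ^* - PW(QD)^* is the derivative of a function vanishing at 0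
    and 1. *)

From mathcomp Require Import all_boot all_order all_algebra.
From mathcomp Require Import complex ring lra.
From mathcomp Require Import all_classical all_reals all_analysis.
Require Import Defs.

Set Implicit Arguments.
Unset Strict Implicit.
Unset Printing Implicit Defensive.

Import Order.TTheory GRing.Theory Num.Theory.
Import numFieldNormedType.Exports.

Local Open Scope classical_set_scope.
Local Open Scope ring_scope.
Local Open Scope complex_scope.
Local Open Scope sesquilinear_scope.

(** * Calculus of complex and matrix valued functions *)

Section ComplexCalculus.
Variable R : realType.
Implicit Types (f g : R -> R[i]) (x : R) (d e : R[i]).

(** The polynomials [gen n] are the images of the monomials of degree [L] under the linear
    substitution with rows (alpha, beta) and (beta, alpha). This substitution commutes with the swap
    of the two variables. The derivation attached to the swap is J on the row index and E + F on the
    column index, hence J Psi = Psi (E + F). The substitution does not commute with the grading H;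
    moving H across it gives E - F - c H, up to the factor z = i sin t, where c = cos t. Since z is
    imaginary, only z^2 passes unchanged through an adjoint. The condition nu >= 1 makes the
    exponent nu - 1/2 positive, so W is continuous on [0, 1] and vanishes at both ends.
    Integrability and boundary terms then reduce to continuity on the closed interval. The
    derivative of W may be singular at the ends, but it never enters an integrand: the symmetry
    equations express every derivative that occurs through F1 W and F0 W. *)

Lemma cReD (a b : R[i]) : complex.Re (a + b) = complex.Re a + complex.Re b.
Proof. by case: a; case: b. Qed.

Lemma cImD (a b : R[i]) : complex.Im (a + b) = complex.Im a + complex.Im b.
Proof. by case: a; case: b. Qed.

Lemma cRe_sum (I : Type) (r : seq I) (F : I -> R[i]) :
  complex.Re (\sum_(i <- r) F i) = \sum_(i <- r) complex.Re (F i).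
Proof. by rewrite (big_morph (@complex.Re R) cReD (erefl _)). Qed.

Lemma cIm_sum (I : Type) (r : seq I) (F : I -> R[i]) :
  complex.Im (\sum_(i <- r) F i) = \sum_(i <- r) complex.Im (F i).
Proof. by rewrite (big_morph (@complex.Im R) cImD (erefl _)). Qed.

Lemma cReN (a : R[i]) : complex.Re (- a) = - complex.Re a.
Proof. by case: a. Qed.

Lemma cImN (a : R[i]) : complex.Im (- a) = - complex.Im a.
Proof. by case: a. Qed.

Lemma cReJ (a : R[i]) : complex.Re a^* = complex.Re a.
Proof. by case: a. Qed.

Lemma cImJ (a : R[i]) : complex.Im a^* = - complex.Im a.
Proof. by case: a. Qed.

Lemma cReM (a b : R[i]) :
  complex.Re (a * b) = complex.Re a * complex.Re b - complex.Im a * complex.Im b.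
Proof. by case: a; case: b. Qed.

Lemma cImM (a b : R[i]) :
  complex.Im (a * b) = complex.Re a * complex.Im b + complex.Im a * complex.Re b.
Proof. by case: a; case: b => ? ? ? ? /=. Qed.

(** Split into real and imaginary parts because smoothness and integrals of complex functions are
    defined by parts. *)
Definition is_cderive x f d :=
  is_derive x 1 (fun y => complex.Re (f y)) (complex.Re d) /\
  is_derive x 1 (fun y => complex.Im (f y)) (complex.Im d).

Lemma is_cderive_eq x f d e : is_cderive x f d -> d = e -> is_cderive x f e.
Proof. by move=> ? <-. Qed.

Lemma is_cderive_cst x d : is_cderive x (fun=> d) 0.
Proof. by split; exact: is_derive_cst. Qed.

Lemma is_cderive_real x (f : R -> R) (d : R) :
  is_derive x 1 f d -> is_cderive x (fun y => (f y)%:C) d%:C.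
Proof. by split => //=; exact: is_derive_cst. Qed.

Lemma is_cderiveD x f g d e : is_cderive x f d -> is_cderive x g e ->
  is_cderive x (fun y => f y + g y) (d + e).
Proof.
move=> [f1 f2] [g1 g2]; split.
- rewrite (_ : (fun y => _) =
    (fun y => complex.Re (f y)) + (fun y => complex.Re (g y))).
    by rewrite cReD; exact: is_deriveD.
  by apply/funext => y; rewrite cReD.
- rewrite (_ : (fun y => _) =
    (fun y => complex.Im (f y)) + (fun y => complex.Im (g y))).
    by rewrite cImD; exact: is_deriveD.
  by apply/funext => y; rewrite cImD.
Qed.

Lemma is_cderiveM x f g d e : is_cderive x f d -> is_cderive x g e ->
  is_cderive x (fun y => f y * g y) (d * g x + f x * e).
Proof.
move=> [f1 f2] [g1 g2]; split.
- rewrite (_ : (fun y => _) =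
    (fun y => complex.Re (f y)) * (fun y => complex.Re (g y)) -
    (fun y => complex.Im (f y)) * (fun y => complex.Im (g y))).
    apply: is_derive_eq (is_deriveB (is_deriveM f1 g1) (is_deriveM f2 g2)) _.
    by rewrite cReD !cReM /GRing.scale /=; ring.
  by apply/funext => y; rewrite cReM.
- rewrite (_ : (fun y => _) =
    (fun y => complex.Re (f y)) * (fun y => complex.Im (g y)) +
    (fun y => complex.Im (f y)) * (fun y => complex.Re (g y))).
    apply: is_derive_eq (is_deriveD (is_deriveM f1 g2) (is_deriveM f2 g1)) _.
    by rewrite cImD !cImM /GRing.scale /=; ring.
  by apply/funext => y; rewrite cImM.
Qed.

Lemma is_cderive_sum x (I : Type) (r : seq I) (f : I -> R -> R[i])
    (d : I -> R[i]) : (forall i, is_cderive x (f i) (d i)) ->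
  is_cderive x (fun y => \sum_(i <- r) f i y) (\sum_(i <- r) d i).
Proof.
move=> fd; elim: r => [|i r IHr].
  under eq_fun do rewrite big_nil.
  by rewrite big_nil; exact: is_cderive_cst.
under eq_fun do rewrite big_cons.
by rewrite big_cons; exact: is_cderiveD.
Qed.

Lemma is_cderive_conj x f d :
  is_cderive x f d -> is_cderive x (fun y => (f y)^*) d^*.
Proof.
move=> [f1 f2]; split.
  by rewrite cReJ; under eq_fun do rewrite cReJ.
rewrite (_ : (fun y => _) = - (fun y => complex.Im (f y))).
  by rewrite cImJ; exact: is_deriveN.
by apply/funext => y; rewrite cImJ.
Qed.

Lemma is_derive_onem x : is_derive x 1 (fun y : R => 1 - y) (-1).
Proof.
rewrite -(sub0r 1).
exact: (is_deriveB (is_derive_cst (1 : R) x 1) (is_derive_id x 1)).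
Qed.

End ComplexCalculus.

Section OpenUnitInterval.
Variables (R : realType) (x : R).
Hypothesis x01 : x \in `]0, 1[.

Lemma itv01W : 0 <= x <= 1.
Proof. by move: x01; rewrite in_itv /= => /andP[/ltW -> /ltW ->]. Qed.

Lemma itv01_gt0 : 0 < x * (1 - x).
Proof. by move: x01; rewrite in_itv /= => /andP[? ?]; rewrite mulr_gt0 ?subr_gt0. Qed.

End OpenUnitInterval.

Section Entries.
Variables (K : pzRingType) (m n : nat).
Implicit Types A B : 'M[K]_(m, n).

Lemma mxDE A B i j : (A + B) i j = A i j + B i j.
Proof. by rewrite mxE. Qed.

Lemma mxNE A i j : (- A) i j = - A i j.
Proof. by rewrite mxE. Qed.

Lemma mxZE a A i j : (a *: A) i j = a * A i j.
Proof. by rewrite mxE. Qed.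

Lemma scalar_mxE (a : K) (i j : 'I_n) : (a%:M : 'M[K]_n) i j = a *+ (i == j).
Proof. by rewrite mxE. Qed.

End Entries.

Section Adjoint.
Variable C : numClosedFieldType.

Lemma adjmxM m n p (A : 'M[C]_(m, n)) (B : 'M[C]_(n, p)) :
  (A *m B) ^t* = B ^t* *m A ^t*.
Proof. by rewrite trmx_mul map_mxM. Qed.

Lemma adjmxK m n (A : 'M[C]_(m, n)) : (A ^t*) ^t* = A.
Proof. by apply/matrixP => i j; rewrite !mxE conjCK. Qed.

Lemma adjmxB m n (A B : 'M[C]_(m, n)) : (A - B) ^t* = A ^t* - B ^t*.
Proof. by apply/matrixP => i j; rewrite !mxE rmorphB. Qed.

Lemma adjmxD m n (A B : 'M[C]_(m, n)) : (A + B) ^t* = A ^t* + B ^t*.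
Proof. by apply/matrixP => i j; rewrite !mxE rmorphD. Qed.

Lemma adjmxZ m n a (A : 'M[C]_(m, n)) : (a *: A) ^t* = Num.conj a *: A ^t*.
Proof. by apply/matrixP => i j; rewrite !mxE rmorphM. Qed.

End Adjoint.

Section MatrixCalculus.
Variable R : realType.
Local Notation C := R[i].
Implicit Type x : R.

Definition is_mderive m n x (F : R -> 'M[C]_(m, n)) (D : 'M[C]_(m, n)) :=
  forall i j, is_cderive x (fun y => F y i j) (D i j).

Lemma is_mderive_eq m n x (F : R -> 'M[C]_(m, n)) D E :
  is_mderive x F D -> D = E -> is_mderive x F E.
Proof. by move=> ? <-. Qed.

Lemma is_mderive_cst m n x (A : 'M[C]_(m, n)) : is_mderive x (fun=> A) 0.
Proof. by move=> i j; rewrite mxE; exact: is_cderive_cst. Qed.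

Lemma is_mderiveD m n x (F G : R -> 'M[C]_(m, n)) D E :
  is_mderive x F D -> is_mderive x G E ->
  is_mderive x (fun y => F y + G y) (D + E).
Proof.
move=> FD GE i j; under eq_fun do rewrite mxE.
by rewrite mxE; exact: is_cderiveD.
Qed.

Lemma is_mderiveM m n p x (F : R -> 'M[C]_(m, n)) (G : R -> 'M[C]_(n, p)) D E :
  is_mderive x F D -> is_mderive x G E ->
  is_mderive x (fun y => F y *m G y) (D *m G x + F x *m E).
Proof.
move=> FD GE i j; under eq_fun do rewrite mxE.
rewrite !mxE -big_split /=; apply: is_cderive_sum => k.
exact: is_cderiveM.
Qed.

Lemma is_mderiveZ m n x (f : R -> C) (F : R -> 'M[C]_(m, n)) d D :
  is_cderive x f d -> is_mderive x F D ->
  is_mderive x (fun y => f y *: F y) (d *: F x + f x *: D).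
Proof.
move=> fd FD i j; under eq_fun do rewrite mxE.
by rewrite !mxE; exact: is_cderiveM.
Qed.

Lemma is_mderiveMl m n p x (A : 'M[C]_(m, n)) (F : R -> 'M[C]_(n, p)) D :
  is_mderive x F D -> is_mderive x (fun y => A *m F y) (A *m D).
Proof.
move=> FD; apply: is_mderive_eq (is_mderiveM (is_mderive_cst x A) FD) _.
by rewrite mul0mx add0r.
Qed.

Lemma is_mderiveMr m n p x (F : R -> 'M[C]_(m, n)) (A : 'M[C]_(n, p)) D :
  is_mderive x F D -> is_mderive x (fun y => F y *m A) (D *m A).
Proof.
move=> FD; apply: is_mderive_eq (is_mderiveM FD (is_mderive_cst x A)) _.
by rewrite mulmx0 addr0.
Qed.

Lemma is_mderiveB m n x (F G : R -> 'M[C]_(m, n)) D E :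
  is_mderive x F D -> is_mderive x G E ->
  is_mderive x (fun y => F y - G y) (D - E).
Proof.
move=> FD GE; apply: (is_mderiveD FD).
have := is_mderiveMl (- 1%:M) GE.
by rewrite mulNmx mul1mx; under eq_fun do rewrite mulNmx mul1mx.
Qed.

Lemma is_mderive_adj m n x (F : R -> 'M[C]_(m, n)) D :
  is_mderive x F D -> is_mderive x (fun y => (F y) ^t*) (D ^t*).
Proof.
move=> FD i j; under eq_fun do rewrite !mxE.
by rewrite !mxE; exact: is_cderive_conj.
Qed.

Lemma is_mderive_mxeval N x (P : {poly 'M[C]_N.+1}) :
  is_mderive x (mxeval P) (mxeval P^`() x).
Proof.
have Xd : is_mderive x (fun y => (y%:C)%:M : 'M[C]_N.+1) 1%:M.
  move=> i j; under eq_fun do rewrite mxE -mulr_natr.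
  have dy : is_cderive x (fun y : R => y%:C) (1 : R)%:C.
    exact: is_cderive_real (is_derive_id x (1 : R)).
  apply: is_cderive_eq (_ : is_cderive _ (fun y : R => y%:C * (i == j)%:R) _) _.
    exact: is_cderiveM dy (is_cderive_cst x _).
  by rewrite mulr0 addr0 mul1r mxE.
rewrite /mxeval; elim/poly_ind: P => [|P c IHP].
  rewrite deriv0 horner0; under eq_fun do rewrite horner0.
  exact: is_mderive_cst.
under eq_fun do rewrite hornerMXaddC.
apply: is_mderive_eq (is_mderiveD (is_mderiveM IHP Xd) (is_mderive_cst x c)) _.
by rewrite derivMXaddC hornerD hornerMX addr0 mulmx1 addrC -mulmxE.
Qed.

End MatrixCalculus.

(** * Symmetry equations *)

Section UnitInterval.
Variable R : realType.

Definition cont01 (f : R -> R) := {within `[0, 1], continuous f}.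

Lemma cont01D (f g : R -> R) : cont01 f -> cont01 g ->
  cont01 (fun y => f y + g y).
Proof. by move=> cf cg x; apply: cvgD; [exact: cf | exact: cg]. Qed.

Lemma cont01N (f : R -> R) : cont01 f -> cont01 (fun y => - f y).
Proof. by move=> cf x; apply: cvgN; exact: cf. Qed.

Lemma cont01B (f g : R -> R) : cont01 f -> cont01 g ->
  cont01 (fun y => f y - g y).
Proof. by move=> cf cg; exact/cont01D/cont01N. Qed.

Lemma cont01M (f g : R -> R) : cont01 f -> cont01 g ->
  cont01 (fun y => f y * g y).
Proof. by move=> cf cg x; apply: cvgM; [exact: cf | exact: cg]. Qed.

Lemma cont01_cst (a : R) : cont01 (fun=> a).
Proof. by move=> x; exact: cvg_cst. Qed.

Lemma is_derive_cont01 (f f' : R -> R) :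
  (forall x : R, is_derive x 1 f (f' x)) -> cont01 f.
Proof.
move=> ff'; apply: derivable_within_continuous => x _.
by have := ff' x; case.
Qed.

Lemma cont01_integrable (f : R -> R) : cont01 f -> integrable01 f.
Proof.
move=> cf; rewrite /integrable01; apply: (@integrableS _ _ _ lebesgue_measure `[0, 1]) => //.
  by apply: subset_itvW.
by apply: continuous_compact_integrable => //; exact: segment_compact.
Qed.

(** The difference of the integrals is G 1 - G 0. Passing to the closed interval lets the
    fundamental theorem apply with [G] merely continuous at the ends and differentiable inside. *)
Lemma Rintegral01_eq (f g G : R -> R) : cont01 f -> cont01 g -> cont01 G ->
  (forall x : R, x \in `]0, 1[ -> is_derive x 1 G (f x - g x)) ->
  G 0 = G 1 ->
  \int[@lebesgue_measure R]_(y in `]0, 1[) f y =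
  \int[@lebesgue_measure R]_(y in `]0, 1[) g y.
Proof.
move=> cf cg cG dG G01; apply/eqP; rewrite -subr_eq0 -RintegralB //=;
  [|exact: cont01_integrable..].
rewrite Rintegral_itv_obnd_cbnd; last exact/cont01_integrable/cont01B.
rewrite Rintegral_itv_bndo_bndc; last first.
  apply: (@integrableS _ _ _ lebesgue_measure `[0, 1]) => //.
    by move=> x /=; rewrite !in_itv /= => /andP[-> /ltW].
  apply: continuous_compact_integrable; first exact: segment_compact.
  exact: cont01B.
rewrite /Rintegral (@continuous_FTC2 _ _ G) //=.
- by rewrite G01 subrr.
- exact: cont01B.
- have /(continuous_within_itvP _ (@ltr01 R)) [_ ? ?] := cG.
  by split => // x /dG; case.
- by move=> x /dG dGx; rewrite derive1E derive_val.
Qed.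

Definition ccont01 (f : R -> R[i]) :=
  cont01 (fun y => complex.Re (f y)) /\ cont01 (fun y => complex.Im (f y)).

Lemma cintegral01_eq (f g G : R -> R[i]) : ccont01 f -> ccont01 g -> ccont01 G ->
  (forall x : R, x \in `]0, 1[ -> is_cderive x G (f x - g x)) ->
  G 0 = G 1 -> cintegral01 f = cintegral01 g.
Proof.
move=> [f1 f2] [g1 g2] [G1 G2] dG G01; rewrite /cintegral01; congr Complex.
  apply: (Rintegral01_eq f1 g1 G1) => [x /dG [d _]|]; last by rewrite G01.
  by rewrite cReD cReN in d.
apply: (Rintegral01_eq f2 g2 G2) => [x /dG [_ d]|]; last by rewrite G01.
by rewrite cImD cImN in d.
Qed.

Definition mcont01 m n (F : R -> 'M[R[i]]_(m, n)) :=
  forall i j, ccont01 (fun y => F y i j).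

Lemma cont01_sum (I : Type) (r : seq I) (f : I -> R -> R) :
  (forall i, cont01 (f i)) -> cont01 (fun y => \sum_(i <- r) f i y).
Proof.
move=> cf; elim: r => [|i r IHr].
  by under eq_fun do rewrite big_nil; exact: cont01_cst.
by under eq_fun do rewrite big_cons; exact: cont01D.
Qed.

Lemma mcont01D m n (F G : R -> 'M[R[i]]_(m, n)) :
  mcont01 F -> mcont01 G -> mcont01 (fun y => F y + G y).
Proof.
move=> cF cG i j; have [? ?] := cF i j; have [? ?] := cG i j.
by split; under eq_fun do rewrite mxE ?(cReD, cImD); exact: cont01D.
Qed.

Lemma mcont01M m n p (F : R -> 'M[R[i]]_(m, n)) (G : R -> 'M[R[i]]_(n, p)) :
  mcont01 F -> mcont01 G -> mcont01 (fun y => F y *m G y).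
Proof.
move=> cF cG i j; split.
  under eq_fun do rewrite mxE cRe_sum.
  apply: cont01_sum => k; under eq_fun do rewrite cReM.
  have [? ?] := cF i k; have [? ?] := cG k j.
  by apply: cont01B; exact: cont01M.
under eq_fun do rewrite mxE cIm_sum.
apply: cont01_sum => k; under eq_fun do rewrite cImM.
have [? ?] := cF i k; have [? ?] := cG k j.
by apply: cont01D; exact: cont01M.
Qed.

Lemma is_mderive_cont01 m n (F F' : R -> 'M[R[i]]_(m, n)) :
  (forall x, is_mderive x F (F' x)) -> mcont01 F.
Proof.
move=> FF' i j; split.
  by apply: is_derive_cont01 => x; case: (FF' x i j).
by apply: is_derive_cont01 => x; case: (FF' x i j).
Qed.

Lemma mcont01_adj m n (F : R -> 'M[R[i]]_(m, n)) :
  mcont01 F -> mcont01 (fun y => (F y) ^t*).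
Proof.
move=> cF i j; have [? ?] := cF j i; split.
  by under eq_fun do rewrite !mxE cReJ.
by under eq_fun do rewrite !mxE cImJ; exact: cont01N.
Qed.

Lemma mcont01_mxeval N (P : {poly 'M[R[i]]_N.+1}) : mcont01 (mxeval P).
Proof. by apply: is_mderive_cont01 => x; exact: is_mderive_mxeval. Qed.

Lemma mcont01_cst m n (A : 'M[R[i]]_(m, n)) : mcont01 (fun=> A).
Proof. by move=> i j; split; exact: cont01_cst. Qed.

End UnitInterval.

Section Symmetry.
Variables (R : realType) (N : nat).
Local Notation M := 'M[R[i]]_N.+1.
Implicit Types (P Q : {poly M}) (x : R).

Lemma mxevalD P Q x : mxeval (P + Q) x = mxeval P x + mxeval Q x.
Proof. exact: hornerD. Qed.

Lemma mxevalM P Q x : mxeval (P * Q) x = mxeval P x *m mxeval Q x.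
Proof.
rewrite mulmxE; apply: hornerM_comm; rewrite /comm_poly.
by rewrite -mulmxE scalar_mxC.
Qed.

Lemma mxinner_eq (W V : R -> M) P Q S T (G : R -> M) :
  mcont01 W -> mcont01 V -> mcont01 G ->
  (forall x, x \in `]0, 1[ -> is_mderive x G
     (mxeval P x *m W x *m (mxeval Q x) ^t* -
      mxeval S x *m V x *m (mxeval T x) ^t*)) ->
  G 0 = G 1 -> mxinner W P Q = mxinner V S T.
Proof.
move=> cW cV cG dG G01; apply/matrixP => i j.
have innerE (V' : R -> M) A B : mxinner V' A B i j =
    cintegral01 (fun y => (mxeval A y *m V' y *m (mxeval B y) ^t*) i j).
  by rewrite mxE.
refine (etrans (innerE W P Q) (etrans _ (esym (innerE V S T)))).
have cl A B (Z : R -> M) : mcont01 Z ->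
    mcont01 (fun y => mxeval A y *m Z y *m (mxeval B y) ^t*).
  move=> cZ; apply: mcont01M; last exact/mcont01_adj/mcont01_mxeval.
  by apply: mcont01M => //; exact: mcont01_mxeval.
apply: (cintegral01_eq (cl P Q W cW i j) (cl S T V cV i j) (cG i j)).
  by move=> x /dG /(_ i j); rewrite mxDE mxNE.
by rewrite G01.
Qed.


(** Pure algebra behind the Green formula: [p0], [p1], [p2] and [q0], [q1], [q2] stand for the
    derivatives of P and Q^*, and S', A' for those of S = F2 W and of the skew half A of F1 W. The
    left side is what the product rule gives for P' S Q^* - P S Q'^* + P A Q^*. *)
Lemma symmetry_identity (p0 p1 p2 q0 q1 q2 f0 f1 f2 g0 g1 g2 w S S' A A' : M) :
  f2 *m w = S -> w *m g2 = S -> f1 *m w = S' + A -> w *m g1 = S' - A ->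
  f0 *m w - w *m g0 = A' ->
  (p2 *m S *m q0 + p1 *m S' *m q0 + p1 *m S *m q1) -
    (p1 *m S *m q1 + p0 *m S' *m q1 + p0 *m S *m q2) +
    (p1 *m A *m q0 + p0 *m A' *m q0 + p0 *m A *m q1) =
  (p2 *m f2 + p1 *m f1 + p0 *m f0) *m w *m q0 -
    p0 *m w *m (g2 *m q2 + g1 *m q1 + g0 *m q0).
Proof.
move=> f2w wg2 f1w wg1 <-.
have mA (a b c d : M) : a *m b *m c *m d = a *m (b *m c) *m d.
  by rewrite !mulmxA.
rewrite !(mulmxDl, mulmxDr) !(mulmxA _ _ q0, mulmxA _ _ q1, mulmxA _ _ q2).
rewrite !mA f2w wg2 f1w wg1 !(mulmxDl, mulmxDr, mulmxN, mulNmx).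
by apply/matrixP => i j; rewrite !(mxDE, mxNE); ring.
Qed.

(** The usual last equation (F2 W)'' - (F1 W)' + F0 W = W F0^* is made first order by substituting
    the derivative of the equation for (F2 W)'. No second derivative of [W] is then needed. *)
Lemma symmetry_equations (W : R -> M) (D : diff_op R N) :
  let F2 := mxeval (dcoef2 D) in let F1 := mxeval (dcoef1 D) in
  let F0 := mxeval (dcoef0 D) in
  mcont01 W -> W 0 = 0 -> W 1 = 0 ->
  (forall x, F2 x *m W x = W x *m (F2 x) ^t*) ->
  (forall x, x \in `]0, 1[ -> is_mderive x (fun y => F2 y *m W y)
     (2^-1 *: (F1 x *m W x + W x *m (F1 x) ^t*))) ->
  (forall x, x \in `]0, 1[ -> is_mderive x
     (fun y => 2^-1 *: (F1 y *m W y - W y *m (F1 y) ^t*))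
     (F0 x *m W x - W x *m (F0 x) ^t*)) ->
  forall P Q, mxinner W (diff_act P D) Q = mxinner W P (diff_act Q D).
Proof.
move=> F2 F1 F0 cW W0 W1 F2W dS dA P Q.
pose S y := F2 y *m W y; pose A y := 2^-1 *: (F1 y *m W y - W y *m (F1 y) ^t*).
pose p k := mxeval (P^`(k)); pose q k y := (mxeval (Q^`(k)) y) ^t*.
have dp k x : is_mderive x (p k) (p k.+1 x).
  by rewrite /p derivnS; exact: is_mderive_mxeval.
have dq k x : is_mderive x (q k) (q k.+1 x).
  by rewrite /q derivnS; exact/is_mderive_adj/is_mderive_mxeval.
have cp k : mcont01 (p k) by exact: mcont01_mxeval.
have cq k : mcont01 (q k) by exact/mcont01_adj/mcont01_mxeval.
have cS : mcont01 S by apply: mcont01M => //; exact: mcont01_mxeval.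
have cA : mcont01 A.
  have h : mcont01 (fun=> (2^-1)%:M : M) by exact: mcont01_cst.
  have := mcont01M h (mcont01D (mcont01M (mcont01_mxeval (dcoef1 D)) cW)
    (mcont01M (mcont01M (@mcont01_cst R _ _ (- 1%:M)) cW)
       (mcont01_adj (mcont01_mxeval (dcoef1 D))))).
  by under eq_fun do rewrite mul_scalar_mx !mulNmx mul1mx.
(* The bilinear concomitant of [D]. Each of its terms contains a factor [W], so it vanishes at 0 and
   1. *)
pose G y := p 1%N y *m S y *m q 0%N y - p 0%N y *m S y *m q 1%N y
  + p 0%N y *m A y *m q 0%N y.
apply: (@mxinner_eq W W _ _ _ _ G cW cW).
- apply: mcont01D; last by do 2 apply: mcont01M => //.
  apply: mcont01D; first by do 2 apply: mcont01M => //.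
  have := mcont01M (mcont01M (mcont01M (@mcont01_cst R _ _ (- 1%:M)) (cp 0%N)) cS)
    (cq 1%N).
  by under eq_fun do rewrite !mulNmx mul1mx.
- move=> x x01.
  have dPSQ k l := is_mderiveM (is_mderiveM (dp k x) (dS x x01)) (dq l x).
  have dPAQ k l := is_mderiveM (is_mderiveM (dp k x) (dA x x01)) (dq l x).
  have := is_mderiveD (is_mderiveB (dPSQ 1%N 0%N) (dPSQ 0%N 1%N)) (dPAQ 0%N 0%N).
  move=> dG; apply: is_mderive_eq dG _.
  rewrite /diff_act !mxevalD !mxevalM !adjmxD !adjmxM !mulmxDl -!/(F2 x) -!/(F1 x).
  have half (a b : M) : 2^-1 *: (a + b) + 2^-1 *: (a - b) = a.
    rewrite -scalerDr addrACA subrr addr0 (_ : a + a = 2%:R *: a).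
      by rewrite scalerA mulVf ?scale1r ?pnatr_eq0.
    by rewrite scaler_nat mulr2n.
  have half' (a b : M) : 2^-1 *: (a + b) - 2^-1 *: (a - b) = b.
    by rewrite -(opprB b) scalerN opprK (addrC a) half.
  have := symmetry_identity (p 0%N x) (p 1%N x) (p 2%N x) (q 0%N x) (q 1%N x)
    (q 2%N x) (erefl (F2 x *m W x)) (esym (F2W x)) (esym (half _ _))
    (esym (half' _ _)) (erefl (F0 x *m W x - W x *m (F0 x) ^t*)).
  by move=> /(_ (F1 x) ((F1 x) ^t*)); rewrite !mulmxDl.
- by rewrite /G /S /A W0 W1 !(mulmx0, mul0mx, subr0, scaler0).
Qed.

End Symmetry.

(** * The generating polynomials of the rows of Psi *)

Section GeneratingPolynomial.
Variables (K : numFieldType) (L : nat) (al be : K).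
Implicit Types n m : nat.

Definition genp : {poly K} := al%:P + be%:P * 'X.
Definition genq : {poly K} := be%:P + al%:P * 'X.
Definition gen n : {poly K} := genp ^+ n * genq ^+ (L - n).

Lemma deriv_gen n : (gen n)^`() =
  n%:R * be%:P * (genp ^+ n.-1 * genq ^+ (L - n)) +
  (L - n)%:R * al%:P * (genp ^+ n * genq ^+ (L - n).-1).
Proof.
have dp : genp^`() = be%:P.
  by rewrite /genp derivD derivM !derivC derivX mul0r !add0r mulr1.
have dq : genq^`() = al%:P.
  by rewrite /genq derivD derivM !derivC derivX mul0r !add0r mulr1.
rewrite /gen derivM !deriv_exp dp dq.
rewrite -(mulr_natl (be%:P * _)) -(mulr_natl (al%:P * _)).
by move: (genp ^+ _) (genq ^+ _) (genq ^+ _) => u v w; ring.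
Qed.

(** [u n] and [v n] are the partial derivatives of [gen n] with respect to [genp] and [genq]; the
    identities below become linear in them. The truncations in [n.-1] and [(L - n).-1] do no harm,
    since the factor n or L - n vanishes there. *)
Let u n := n%:R * genp ^+ n.-1 * genq ^+ (L - n).
Let v n := (L - n)%:R * genp ^+ n * genq ^+ (L - n).-1.

Let deriv_gen_uv n : (gen n)^`() = be%:P * u n + al%:P * v n.
Proof. by rewrite deriv_gen /u /v; move: (_%:R) (_%:R) => a b; ring. Qed.

Let gen_u n : n%:R * gen n = genp * u n.
Proof.
rewrite /gen /u; case: n => [|n] /=; first by rewrite !mul0r mulr0.
by rewrite exprS; move: (_%:R) => a; ring.
Qed.

Let gen_v n : (L - n)%:R * gen n = genq * v n.
Proof.
rewrite /gen /v; case: (L - n)%N => [|k] /=; first by rewrite !mul0r mulr0.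
by rewrite exprS; move: (_%:R) => a; ring.
Qed.

Let gen_L n : (n <= L)%N -> L%:R * gen n = genp * u n + genq * v n.
Proof.
by move=> nL; rewrite -gen_u -gen_v -mulrDl -natrD subnKC.
Qed.

Let gen_pred n : (n <= L)%N -> n%:R * gen n.-1 = genq * u n.
Proof.
rewrite /gen /u; case: n => [|n] nL /=; first by rewrite !mul0r mulr0.
by rewrite -(subnSK nL) exprS; move: (_%:R) => a; ring.
Qed.

Let gen_succ n : (L - n)%:R * gen n.+1 = genp * v n.
Proof. by rewrite /gen /v subnS exprS; move: (_%:R) => a; ring. Qed.

(** If al' = r (c al - be) and be' = r (c be - al), then genp' = r (c genp - genq) and symmetrically
    for genq, so the left side is the derivative of [gen n] along such a path. *)
Lemma gen_derivation n (r c : K) : (n <= L)%N ->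
  n%:R * genp ^+ n.-1 * (r%:P * (c%:P * genp - genq)) * genq ^+ (L - n) +
  genp ^+ n * ((L - n)%:R * genq ^+ (L - n).-1 * (r%:P * (c%:P * genq - genp))) =
  r%:P * (c%:P * (L%:R * gen n) - (n%:R * gen n.-1 + (L - n)%:R * gen n.+1)).
Proof.
move=> nL; rewrite gen_L // gen_pred // gen_succ.
have -> : n%:R * genp ^+ n.-1 * (r%:P * (c%:P * genp - genq)) * genq ^+ (L - n) =
    r%:P * (c%:P * genp - genq) * u n.
  by rewrite /u; move: (_%:R) => a; ring.
rewrite (mulrCA (genp ^+ n)) mulrA /v.
move: (u n) (_%:R) => a b; ring.
Qed.

(** The left side is genq [u n] + genp [v n]. Substituting genq = X genp + (1 - X^2) be and genp = X
    genq + (1 - X^2) al leaves Euler's relation and the derivative in X. *)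
Lemma gen_raise_lower n : (n <= L)%N ->
  n%:R * gen n.-1 + (L - n)%:R * gen n.+1 =
  'X * (L%:R * gen n) + (1 - 'X^2) * (gen n)^`().
Proof.
move=> nL; rewrite gen_L // deriv_gen_uv gen_pred // gen_succ.
rewrite /genp /genq; move: (u n) (v n) => a b; ring.
Qed.

(** The left side is z (genp [u n] - genq [v n]). The two hypotheses rewrite z genp and z genq so
    that z disappears from the right. *)
Lemma gen_weight n c z : (n <= L)%N -> c * al - be = z * al ->
  al - c * be = z * be ->
  z%:P * (n%:R * gen n - (L - n)%:R * gen n) =
  - c%:P * (2 * 'X * (gen n)^`() - L%:R * gen n) +
    ('X * (L%:R * gen n) - (1 + 'X^2) * (gen n)^`()).
Proof.
move=> nL e1 e2; rewrite gen_L // gen_u gen_v deriv_gen_uv.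
have f1 : z%:P * al%:P = c%:P * al%:P - be%:P by rewrite -!polyCM -e1 polyCB.
have f2 : z%:P * be%:P = al%:P - c%:P * be%:P by rewrite -!polyCM -e2 polyCB.
have zp : z%:P * genp = - c%:P * (2 * 'X * be%:P - genp)
    + ('X * genp - (1 + 'X^2) * be%:P).
  by rewrite /genp mulrDr mulrA f1 f2; ring.
have zq : z%:P * genq = c%:P * (2 * 'X * al%:P - genq)
    - ('X * genq - (1 + 'X^2) * al%:P).
  by rewrite /genq mulrDr mulrA f1 f2; ring.
rewrite mulrBr !(mulrA z%:P) zp zq.
move: (u n) (v n) => a b; ring.
Qed.

End GeneratingPolynomial.

(** * The matrices acting on rows and columns of Psi *)

Section PsiMatrix.
Variables (K : numFieldType) (L : nat).

Lemma sum_delta (N m : nat) (f : nat -> K) : (m < N)%N ->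
  \sum_(k < N) (k == m :> nat)%:R * f k = f m.
Proof.
move=> mN; rewrite (bigD1 (Ordinal mN)) //= eqxx mul1r big1 ?addr0 // => k.
by rewrite -val_eqE /= => /negPf ->; rewrite mul0r.
Qed.

(** The condition on [a] covers the border: when the neighbouring index leaves the range, its
    coefficient must be zero. *)
Lemma sum_delta_succ (N m : nat) (a : K) (f : nat -> K) :
  (m < N)%N -> ((N <= m.+1)%N -> a = 0) ->
  \sum_(k < N) (k == m.+1 :> nat)%:R * (a * f k) = a * f m.+1.
Proof.
move=> mN a0; have [mN'|Nm] := ltnP m.+1 N.
  by rewrite (sum_delta (fun k => a * f k)).
by rewrite a0 // mul0r big1 // => k _; rewrite mul0r ?mulr0.
Qed.

Lemma sum_delta_pred (N m : nat) (a : K) (f : nat -> K) :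
  (m < N)%N -> (m = 0%N -> a = 0) ->
  \sum_(k < N) (m == k.+1)%:R * (a * f k) = a * f m.-1.
Proof.
case: m => [|m] mN a0.
  by rewrite a0 // mul0r big1 // => k _; rewrite mul0r ?mulr0.
rewrite /= -(sum_delta (fun k => a * f k) (ltnW mN)).
by apply: eq_bigr => k _; rewrite eqSS eq_sym.
Qed.

Definition Jmx : 'M[K]_L.+1 := \matrix_(n, k)
  ((n == k.+1 :> nat)%:R * n%:R + (k == n.+1 :> nat)%:R * (L - n)%:R).

(** On row vectors of coefficients divided by binomials, right multiplication by [Emx], [Fmx], [Hmx]
    is the action of L X - X^2 d/dX, d/dX and 2 X d/dX - L: the standard operators of sl_2 on
    polynomials of degree at most [L]. *)
Definition Emx : 'M[K]_L.+1 := \matrix_(i, j) ((j == i.+1 :> nat)%:R * j%:R).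

Definition Fmx : 'M[K]_L.+1 := \matrix_(i, j)
  ((i == j.+1 :> nat)%:R * (L - j)%:R).

Definition Hmx : 'M[K]_L.+1 := diag_mx (\row_n (n%:R - (L - n)%:R)).

Variables (al be : K).

Definition psi n m : K := (gen L al be n)`_m / 'C(L, m)%:R.

Definition Psimx : 'M[K]_L.+1 := \matrix_(n, m) psi n m.

(** Dividing by binomials exchanges the factors m + 1 and L - m, because (m + 1) C(L, m + 1) = (L -
    m) C(L, m). *)
Lemma psi_pred n m : (m < L)%N ->
  m.+1%:R * psi n m = (L - m)%:R * (gen L al be n)`_m / 'C(L, m.+1)%:R.
Proof.
move=> mL; have C0 k : (k <= L)%N -> 'C(L, k)%:R != 0 :> K.
  by move=> kL; rewrite pnatr_eq0 -lt0n bin_gt0.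
apply: (canRL (mulfK (C0 _ mL))); rewrite mulrAC -natrM mul_bin_left natrM.
by rewrite /psi -mulrA; congr (_ * _); rewrite mulrC mulfVK // C0 // ltnW.
Qed.

Lemma psi_succ n m : (m < L)%N ->
  (L - m)%:R * psi n m.+1 = m.+1%:R * (gen L al be n)`_m.+1 / 'C(L, m)%:R.
Proof.
move=> mL; have C0 k : (k <= L)%N -> 'C(L, k)%:R != 0 :> K.
  by move=> kL; rewrite pnatr_eq0 -lt0n bin_gt0.
apply: (canRL (mulfK (C0 _ (ltnW mL)))).
rewrite mulrAC -natrM -mul_bin_left natrM.
by rewrite /psi -mulrA; congr (_ * _); rewrite mulrC mulfVK // C0.
Qed.

Lemma size_gen n : (n <= L)%N -> (size (gen L al be n) <= L.+1)%N.
Proof.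
have s2 (a b : K) : (size (a%:P + b%:P * 'X)%R <= 2)%N.
  by rewrite addrC size_MXaddC; case: ifP => // _; rewrite ltnS size_polyC leq_b1.
move=> nL; rewrite /gen /genp /genq; apply: leq_trans (size_polyMleq _ _) _.
have sX k (r : {poly K}) : (size r <= 2)%N -> (size (r ^+ k) <= k.+1)%N.
  move=> r2; apply: leq_trans (size_poly_exp_leq _ _) _.
  by rewrite ltnS mulnC -[leqRHS]muln1 leq_mul2l; case: size r2 => [|[|[|]]] //;
    rewrite orbT.
have := leq_add (sX n _ (s2 al be)) (sX (L - n)%N _ (s2 be al)).
by rewrite addSn addnS subnKC // -subn1 leq_subLR add1n.
Qed.

Lemma coef_shift (g : {poly K}) m : (m <= L)%N ->
  ('X * (L%:R * g) - 'X^2 * g^`())`_m =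
  if m is k.+1 then (L - k)%:R * g`_k else 0.
Proof.
rewrite coefB mulr_natl coefXM expr2 -mulrA 2!coefXM.
case: m => [|[|k]] mL /=; rewrite ?subrr // coefMn ?coef_deriv ?subr0 ?subn0 ?mulr_natl //.
by rewrite -mulrnBr // ltnW.
Qed.

Lemma psi_lo n m : (m <= L)%N ->
  m%:R * psi n m.-1 = ('X * (L%:R * gen L al be n) -
    'X^2 * (gen L al be n)^`())`_m / 'C(L, m)%:R.
Proof.
move=> mL; rewrite coef_shift //; case: m mL => [|k] kL; first by rewrite !mul0r.
exact: psi_pred.
Qed.

Lemma psi_hi n m : (n <= L)%N -> (m <= L)%N ->
  (L - m)%:R * psi n m.+1 = (gen L al be n)^`()`_m / 'C(L, m)%:R.
Proof.
move=> nL; rewrite leq_eqVlt => /orP[/eqP ->|mL].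
  rewrite subnn mul0r coef_deriv nth_default ?mul0rn ?mul0r //.
  exact: size_gen.
by rewrite psi_succ // coef_deriv mulr_natl.
Qed.

Lemma psi_raise_lower n m : (n <= L)%N -> (m <= L)%N ->
  n%:R * psi n.-1 m + (L - n)%:R * psi n.+1 m =
  m%:R * psi n m.-1 + (L - m)%:R * psi n m.+1.
Proof.
move=> nL mL; rewrite psi_lo // psi_hi // /psi.
have := congr1 (fun p : {poly K} => p`_m) (gen_raise_lower al be nL).
rewrite coefD !(mulr_natl (gen _ _ _ _)) !coefMn.
move: (gen _ _ _ n.-1) (gen _ _ _ n.+1) (gen _ _ _ n) => g1 g2 g e.
rewrite !(mulrA _%:R) -!mulrDl !(mulr_natl (_`_m)) e -coefD; congr (_ / _).
by congr ((_ : {poly K})`_m); ring.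
Qed.

Lemma psi_weight n m c z : (n <= L)%N -> (m <= L)%N ->
  c * al - be = z * al -> al - c * be = z * be ->
  z * ((n%:R - (L - n)%:R) * psi n m) =
  m%:R * psi n m.-1 - (L - m)%:R * psi n m.+1 -
  c * ((m%:R - (L - m)%:R) * psi n m).
Proof.
move=> nL mL e1 e2; rewrite psi_lo // psi_hi // /psi.
have := congr1 (fun p : {poly K} => p`_m) (gen_weight nL e1 e2).
have : ('X * (gen L al be n)^`())`_m = m%:R * (gen L al be n)`_m.
  by case: m {mL} => [|k]; rewrite coefXM ?mul0r // coef_deriv mulr_natl.
move: (gen _ _ _ n) => g ex e.
rewrite !(mulrA (_ - _)) (mulrA c) (mulrA z) -!mulrBl; congr (_ / _).
have -> : (n%:R - (L - n)%:R) * g`_m = (n%:R * g - (L - n)%:R * g)`_m.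
  by rewrite mulrBl coefB !mulr_natl !coefMn.
rewrite -coefCM e !mulNr coefD coefN coefCM coefB -mulrA.
rewrite addrC; congr (_ - _ * _).
  by rewrite -coefB; congr ((_ : {poly K})`_m); ring.
by rewrite (mulr_natl ('X * _)) (mulr_natl g) !coefMn ex natrB //; ring.
Qed.

Lemma mul_JPsiE (n m : 'I_L.+1) : (Jmx *m Psimx) n m =
  n%:R * psi n.-1 m + (L - n)%:R * psi n.+1 m.
Proof.
rewrite mxE; under eq_bigr do rewrite !mxE mulrDl -!mulrA.
rewrite big_split /= (sum_delta_pred (psi^~ m)) ?ltn_ord //; last by move->.
rewrite (sum_delta_succ (psi^~ m)) ?ltn_ord // ltnS => Ln.
by rewrite (eqP Ln).
Qed.

Lemma mul_JPsi : Jmx *m Psimx = Psimx *m (Emx + Fmx).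
Proof.
apply/matrixP => n m; rewrite mul_JPsiE psi_raise_lower ?leq_ord // mxE.
under [RHS]eq_bigr do rewrite !mxE mulrDr !(mulrC (psi _ _)) -!mulrA.
rewrite big_split /= (sum_delta_pred (psi n)) ?ltn_ord //; last by move->.
rewrite (sum_delta_succ (psi n)) ?ltn_ord // ltnS => Lm.
by rewrite (eqP Lm).
Qed.

Lemma mul_HPsi c z : c * al - be = z * al -> al - c * be = z * be ->
  z *: (Hmx *m Psimx) = Psimx *m (Emx - Fmx - c *: Hmx).
Proof.
move=> e1 e2; rewrite mulmxBr -scalemxAr mul_diag_mx mul_mx_diag.
apply/matrixP => n m; rewrite !mxE (@psi_weight _ _ c) ?leq_ord //.
rewrite (mulrC (_ - _)); congr (_ - _).
under [RHS]eq_bigr do rewrite !mxE mulrBr !(mulrC (psi _ _)) -!mulrA.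
rewrite sumrB (sum_delta_pred (psi n)) ?ltn_ord //; last by move->.
rewrite (sum_delta_succ (psi n)) ?ltn_ord // ltnS => Lk.
by rewrite (eqP Lk).
Qed.

End PsiMatrix.

(** * Nondegeneracy of Psi *)

Section PsiKernel.
Variables (K : numFieldType) (L : nat) (al be : K).

Let h n : K := n%:R - (L - n)%:R.

Let h_inj (i j : 'I_L.+1) : i != j -> h i - h j != 0.
Proof.
have hE (k : 'I_L.+1) : h k = k%:R *+ 2 - L%:R.
  by rewrite /h natrB ?leq_ord // mulr2n; ring.
move=> ij; rewrite !hE (_ : _ - _ = (i%:R - j%:R) * 2); last by ring.
by rewrite mulf_neq0 ?pnatr_eq0 // subr_eq0 eqr_nat.
Qed.

(* The kernel is stable under the diagonal matrix [Hmx], whose eigenvalues are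
   distinct, so it would contain a basis vector. *)
Lemma Psimx_ker0 c z (v : 'rV[K]_L.+1) : z != 0 -> al != 0 -> be != 0 ->
  c * al - be = z * al -> al - c * be = z * be ->
  v *m Psimx L al be = 0 -> v = 0.
Proof.
move=> z0 al0 be0 e1 e2 vP0.
have stab (u : 'rV[K]_L.+1) k : u *m Psimx L al be = 0 ->
    (\row_j (u 0 j * (h j - k))) *m Psimx L al be = 0.
  move=> uP; have -> : \row_j (u 0 j * (h j - k)) = u *m Hmx K L - k *: u.
    by apply/rowP => j; rewrite mul_mx_diag !mxE mulrBr (mulrC k).
  rewrite mulmxBl -scalemxAl uP scaler0 subr0 -mulmxA.
  apply: (scalerI z0); rewrite scaler0 scalemxAr (mul_HPsi _ e1 e2) mulmxA uP.
  by rewrite mul0mx.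
have prodP (s : seq 'I_L.+1) :
    (\row_j (v 0 j * \prod_(k <- s) (h j - h k))) *m Psimx L al be = 0.
  elim: s => [|k s IHs].
    rewrite -vP0; congr (_ *m _); apply/rowP => j.
    by rewrite mxE big_nil mulr1.
  rewrite -{}[RHS](stab _ (h k) IHs); congr (_ *m _); apply/rowP => j.
  by rewrite !mxE big_cons -mulrA (mulrC (\prod_(_ <- _) _)).
apply/rowP => n; rewrite mxE.
(* The product kills every coordinate except the one at [n], where it is nonzero. Column 0 of row
   [n] of Psi is the constant coefficient al^n be^(L-n), also nonzero, so the coordinate of [v] must
   vanish. *)
have /rowP/(_ ord0) := prodP [seq k <- enum 'I_L.+1 | k != n].
rewrite !mxE (bigD1 n) //= big1 ?addr0 => [|j jn]; last first.
  rewrite mxE (_ : \prod_(_ <- _) _ = 0) ?mulr0 ?mul0r //.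
  apply/eqP; rewrite prodf_seq_eq0; apply/hasP; exists j.
    by rewrite mem_filter jn mem_enum.
  by rewrite subrr eqxx.
rewrite !mxE => /eqP; rewrite -mulrA mulf_eq0 => /orP[/eqP //|].
rewrite mulf_eq0 => /orP[|].
  rewrite prodf_seq_eq0 => /hasP[k]; rewrite mem_filter eq_sym => /andP[nk _].
  by rewrite (negPf (h_inj nk)).
rewrite /psi bin0 divr1 /gen -horner_coef0 hornerM !horner_exp /genp /genq !hornerE.
by rewrite mulf_eq0 !expf_eq0 (negPf al0) (negPf be0) !andbF.
Qed.

End PsiKernel.

(** * The identity between E, F, H and T *)

Section WeightIdentity.
Variables (K : numFieldType) (L : nat) (nu : K) (t : nat -> K).
Hypothesis trec : forall n, (n < L)%N ->
  n.+1%:R * t n.+1 * (nu + (L - n)%:R - 1) = (L - n)%:R * t n * (nu + n%:R).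

Local Notation T := (diag_mx (\row_(i < L.+1) t i)).
Local Notation E := (Emx K L).
Local Notation F := (Fmx K L).
Local Notation H := (Hmx K L).
Implicit Type X : 'M[K]_L.+1.

(** The defect of symmetry of X T. Commutators such as J V - V J^* with V = Psi T Psi^* reduce to
    it. *)
Definition skew X := X *m T - T *m X^T.

Lemma skewE X i j : skew X i j = X i j * t j - t i * X j i.
Proof. by rewrite /skew mul_mx_diag mul_diag_mx !mxE. Qed.

Lemma skewD X Y : skew (X + Y) = skew X + skew Y.
Proof. by apply/matrixP => i j; rewrite [RHS]mxE !skewE !mxE; ring. Qed.

Lemma skewZ a X : skew (a *: X) = a *: skew X.
Proof. by apply/matrixP => i j; rewrite [RHS]mxE !skewE !mxE; ring. Qed.

Lemma skew_diag X : (forall i j, i != j -> X i j = 0) -> skew X = 0.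
Proof.
move=> dX; apply/matrixP => i j; rewrite skewE mxE.
have [->|ij] := eqVneq i j; first by rewrite mulrC subrr.
by rewrite (dX i j ij) (dX j i) ?mul0r ?mulr0 ?subrr 1?eq_sym.
Qed.

Lemma skew_EF : skew (E *m F) = 0.
Proof.
apply: skew_diag => i j ij; rewrite mxE big1 // => k _; rewrite !mxE.
case: (eqVneq (k : nat) i.+1) => [ki|_]; last by rewrite /= !mulr0n !mul0r.
case: (eqVneq (k : nat) j.+1) => [kj|_]; last by rewrite /= !(mulr0n, mul0r, mulr0).
by case/eqP: ij; apply/val_inj; move: kj; rewrite ki => -[].
Qed.

Lemma skew_FE : skew (F *m E) = 0.
Proof.
apply: skew_diag => i j ij; rewrite mxE big1 // => k _; rewrite !mxE.
case: (eqVneq (i : nat) k.+1) => [ki|_]; last by rewrite /= !mulr0n !mul0r.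
case: (eqVneq (j : nat) k.+1) => [kj|_]; last by rewrite /= !(mulr0n, mul0r, mulr0).
by case/eqP: ij; apply/val_inj => /=; rewrite ki kj.
Qed.

Lemma skew_HH : skew (H *m H) = 0.
Proof.
apply: skew_diag => i j ij; rewrite mul_diag_mx !mxE.
by rewrite (negPf ij) mulr0n mulr0.
Qed.

(** The one place where the recursion for [t] enters. Both sides live next to the diagonal. There
    neighbouring entries of H add up to 4i + 2 - 2L, which combines with 4 nu - 2 + 2L into 4 (nu +
    L - i - 1) and 4 (nu + i), the factors of the recursion. *)
Lemma skew_linear :
  skew ((4 * nu - 2 + 2 * L%:R) *: (E + F)) = skew ((E - F) *m H + H *m (E - F)).
Proof.
apply/matrixP => i j; rewrite !skewE mul_mx_diag mul_diag_mx !mxE.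
have recij (n m : 'I_L.+1) : m = n.+1 :> nat ->
    m%:R * t m * (nu + (L - n)%:R - 1) = (L - n)%:R * t n * (nu + n%:R).
  by move=> mn; rewrite mn trec // -ltnS -mn ltn_ord.
have natB (k : 'I_L.+1) : (L - k)%:R = L%:R - k%:R :> K.
  by rewrite natrB ?leq_ord.
have [ji|ij] := eqVneq (j : nat) i.+1.
  have -> : (i == j.+1 :> nat) = false by rewrite ji ltn_eqF // leqnSn.
  apply/eqP; rewrite -subr_eq0; apply/eqP.
  have /eqP := recij _ _ ji; rewrite -subr_eq0 => /eqP e.
  rewrite -[RHS](mulr0 4) -[in RHS]e !natB /= ji -natr1; ring.
have [ij'|_] := eqVneq (i : nat) j.+1; last by rewrite /= mulr0n; ring.
apply/eqP; rewrite -subr_eq0; apply/eqP.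
have /eqP := recij _ _ ij'; rewrite -subr_eq0 => /eqP e.
rewrite -[RHS](mulr0 (-4)) -[in RHS]e !natB /= ij' -natr1; ring.
Qed.

(** [skew] kills the diagonal matrices E F, F E and H H, and E E + F F occurs in both squares. Only
    the part linear in [c] is left, which is [skew_linear]. *)
Lemma weight_identity c :
  let M := E - F - c *: H in
  c *: skew ((4 * nu - 2 + 2 * L%:R) *: (E + F)) - skew ((E + F) *m (E + F)) =
  - skew (M *m M).
Proof.
move=> M; apply/eqP; rewrite -addr_eq0 skew_linear.
have -> : M *m M = (E *m E + F *m F) - (E *m F + F *m E)
    - c *: ((E - F) *m H + H *m (E - F)) + c ^+ 2 *: (H *m H).
  rewrite /M !(mulmxBl, mulmxBr) -!scalemxAl -!scalemxAr scalerA -expr2.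
  apply/matrixP => i j.
  rewrite !(mxDE, mxNE, mxZE); ring.
have -> : (E + F) *m (E + F) = (E *m E + F *m F) + (E *m F + F *m E).
  by rewrite mulmxDl !mulmxDr (addrC (F *m E)) addrACA.
have skewN X : skew (- X) = - skew X by rewrite -scaleN1r skewZ scaleN1r.
rewrite !(skewD, skewN, skewZ) skew_EF skew_FE skew_HH.
by rewrite !(addr0, oppr0, scaler0) addrA subrK subrr.
Qed.

End WeightIdentity.

(** * Identification of Psi0 and its derivative *)

Section PsiLink.
Variable R : realType.
Local Notation C := R[i].

Definition alpha (y : R) : C := Num.sqrt (1 - y) +i* Num.sqrt y.
Definition beta (y : R) : C := (alpha y)^*.

Lemma expiD (x y : R) : expi (x + y) = expi x * expi y.
Proof. by rewrite /expi cosD sinD; apply/eqP; rewrite eq_complex /= !eqxx /= addrC. Qed.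

Lemma expi_natM (k : nat) (x : R) : expi x ^+ k = expi (k%:R * x).
Proof.
elim: k => [|k IHk]; first by rewrite mul0r /expi cos0 sin0.
by rewrite exprS IHk -expiD -natr1 mulrDl mul1r addrC.
Qed.

(** The half angle lies in [0, pi/2], where cosine and sine are nonnegative, so both are the
    positive square roots. *)
Lemma expi_half_acos (y : R) : 0 <= y <= 1 ->
  expi (acos (1 - 2 * y) / 2) = alpha y.
Proof.
move=> /andP[y0 y1]; set t := acos _.
have [/andP[t0 tpi] ct] : 0 <= t <= pi /\ cos t = 1 - 2 * y.
  by apply: acos_def; apply/andP; split; lra.
have th : t = t / 2 + t / 2 by lra.
have c2 : cos (t / 2) ^+ 2 = 1 - y.
  by move: ct; rewrite {1}th cosD -!expr2 sin2cos2; lra.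
have s2 : sin (t / 2) ^+ 2 = y by rewrite sin2cos2 c2; lra.
rewrite /expi /alpha -{1}c2 -s2 !sqrtr_sqr !ger0_norm //.
  by apply: sin_ge0_pi; apply/andP; split; lra.
by apply: cos_ge0_pihalf; apply/andP; split; lra.
Qed.

Lemma expi_neg_half_acos (y : R) : 0 <= y <= 1 ->
  expi (- (acos (1 - 2 * y) / 2)) = beta y.
Proof.
by move=> /expi_half_acos; rewrite /beta => <-; rewrite /expi cosN sinN.
Qed.

Lemma coef_gen L (a b : C) (n m : nat) :
  (gen L a b n)`_m = \sum_(i < n.+1) \sum_(j < (L - n).+1)
    (m == (i + j)%N)%:R * ('C(n, i)%:R * 'C(L - n, j)%:R *
      (a ^+ (n - i) * b ^+ i * (b ^+ (L - n - j) * a ^+ j))).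
Proof.
rewrite /gen /genp /genq !exprDn big_distrlr /= coef_sum.
apply: eq_bigr => i _; rewrite coef_sum; apply: eq_bigr => j _.
rewrite !exprMn -!polyC_exp.
have -> : (a ^+ (n - i))%:P * ((b ^+ i)%:P * 'X^i) *+ 'C(n, i) *
  ((b ^+ (L - n - j))%:P * ((a ^+ j)%:P * 'X^j) *+ 'C(L - n, j)) =
  ('C(n, i)%:R * 'C(L - n, j)%:R * (a ^+ (n - i) * b ^+ i * (b ^+ (L - n - j) * a ^+ j)))%:P
    * 'X^(i + j).
  rewrite exprD !polyCM !polyCMn.
  move: ((a ^+ (n - i))%:P) ((b ^+ i)%:P) ((b ^+ (L - n - j))%:P) ((a ^+ j)%:P) => p q r s.
  by rewrite -!(mulr_natl (_ * _)); ring.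
by rewrite coefCM coefXn mulrC.
Qed.

(** Binomial expansion: [a] and [b] count the factors X taken from [genp] and [genq], so the
    Kronecker delta becomes m = a + b. The power of e^(it/2) is (n - 2a) - (L - n - 2b) = 2 (j2 -
    j1). *)
Lemma Psi0E L (y : R) : 0 <= y <= 1 -> Psi0 L y = Psimx L (alpha y) (beta y).
Proof.
move=> y01; apply/matrixP => n m; rewrite !mxE /psi coef_gen big_distrl /=.
apply: eq_bigr => a _; rewrite big_distrl /=; apply: eq_bigr => b _.
have nL : (n <= L)%N by rewrite leq_ord.
have an : (a <= n)%N by rewrite leq_ord.
have bn : (b <= L - n)%N by rewrite leq_ord.
set t := acos _.
have -> : (- (L%:R / 2) + m%:R ==
    a%:R - n%:R / 2 + (b%:R - (L - n)%:R / 2) :> R) = (m == a + b :> nat)%N.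
  rewrite -subr_eq0 -[RHS](eqr_nat R) -[RHS]subr_eq0 natrD natrB //.
  by congr (_ == _); field.
case: eqP => [mab|_]; last by rewrite /= !mul0r.
rewrite /= mul1r bin_sub ?leq_ord // -!mulrA; do 2 congr (_ * _).
rewrite mulrC !mulrA; congr (_ / _); rewrite -!mulrA.
rewrite -expi_half_acos // -expi_neg_half_acos // -/t !expi_natM -!expiD.
by congr (expi _); rewrite !natrB //; field.
Qed.

End PsiLink.

(** * Differentiation of Psi0 in y *)

Section PolyDerivative.
Variable R : realType.
Local Notation C := R[i].
Implicit Types (P : R -> {poly C}) (x : R).

Definition is_pderive x P (Q : {poly C}) :=
  forall m, is_cderive x (fun y => (P y)`_m) Q`_m.

Lemma is_pderiveM x P P' Q Q' : is_pderive x P Q -> is_pderive x P' Q' ->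
  is_pderive x (fun y => P y * P' y) (Q * P' x + P x * Q').
Proof.
move=> PQ PQ' m; under eq_fun do rewrite coefM.
rewrite coefD !coefM -big_split /=; apply: is_cderive_sum => i.
exact: is_cderiveM.
Qed.

Lemma is_pderive_eq x P Q Q' : is_pderive x P Q -> Q = Q' -> is_pderive x P Q'.
Proof. by move=> ? <-. Qed.

Lemma is_pderiveX x P Q n : is_pderive x P Q ->
  is_pderive x (fun y => P y ^+ n) (n%:R * P x ^+ n.-1 * Q).
Proof.
move=> PQ; elim: n => [|n IHn] m.
  apply: is_cderive_eq (is_cderive_cst x (1 : {poly C})`_m) _.
  by rewrite (_ : 0%:R * _ * Q = 0) ?coef0 // -mulrA mul0r.
under eq_fun do rewrite exprS.
apply: is_cderive_eq (is_pderiveM PQ IHn m) _; congr ((_ : {poly C})`_m).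
case: n {IHn} => [|n] /=; first by rewrite !expr0; ring.
by rewrite exprS; move: (P x ^+ n) => p; ring.
Qed.

Lemma is_pderive_linear x (f g : R -> C) d e :
  is_cderive x f d -> is_cderive x g e ->
  is_pderive x (fun y => (f y)%:P + (g y)%:P * 'X) (d%:P + e%:P * 'X).
Proof.
move=> fd ge m; under eq_fun do rewrite coefD coefC coefMX coefC.
rewrite coefD coefC coefMX coefC; apply: is_cderiveD.
  by case: (m == 0%N); [exact: fd | exact: is_cderive_cst].
case: (m == 0%N); first exact: is_cderive_cst.
by case: (m.-1 == 0%N); [exact: ge | exact: is_cderive_cst].
Qed.

(** As beta is the conjugate of alpha, c alpha - beta has real part (c - 1) sqrt(1 - x) and
    imaginary part (c + 1) sqrt x, with c - 1 = -2x and c + 1 = 2 (1 - x). Dividing by 4x(1 - x)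
    gives the derivatives of the two square roots. *)
Lemma is_cderive_alpha x : x \in `]0, 1[ -> is_cderive x (@alpha R)
  ((4 * (x * (1 - x)))^-1%:C * ((1 - 2 * x)%:C * alpha x - beta x)).
Proof.
rewrite in_itv /= => /andP[x0 x1]; have y0 : 0 < 1 - x by rewrite subr_gt0.
have dq := is_derive1_sqrt x0.
have dp : is_derive x 1 (fun y => Num.sqrt (1 - y)) (- (2 * Num.sqrt (1 - x))^-1).
  have := @is_derive1_comp _ _ (fun y => 1 - y) _ _ _ (is_derive1_sqrt y0)
    (is_derive_onem x).
  by rewrite mulrN1.
have sx : 0 < Num.sqrt x by rewrite sqrtr_gt0.
have sy : 0 < Num.sqrt (1 - x) by rewrite sqrtr_gt0.
have ex : x = Num.sqrt x ^+ 2 by rewrite sqr_sqrtr // ltW.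
have ey : 1 - x = Num.sqrt (1 - x) ^+ 2 by rewrite sqr_sqrtr // ltW.
have e1 : - (2 * Num.sqrt (1 - x))^-1 =
    (4 * (x * (1 - x)))^-1 * ((1 - 2 * x - 1) * Num.sqrt (1 - x)).
  move: (Num.sqrt (1 - x)) sy ey => p p0 ->; field.
  by rewrite !gt_eqF.
have e2 : (2 * Num.sqrt x)^-1 =
    (4 * (x * (1 - x)))^-1 * ((1 - 2 * x + 1) * Num.sqrt x).
  rewrite (_ : 1 - 2 * x + 1 = 2 * (1 - x)); last by ring.
  rewrite (_ : x * (1 - x) = Num.sqrt x ^+ 2 * (1 - x)); last by rewrite -ex.
  move: (Num.sqrt x) (1 - x) sx y0 => q y q0 y0; field.
  by rewrite !gt_eqF.
split.
  by rewrite e1 in dp; rewrite cReM /=; apply: is_derive_eq dp _; ring.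
by rewrite e2 in dq; rewrite cImM /=; apply: is_derive_eq dq _; ring.
Qed.

Lemma is_cderive_beta x : x \in `]0, 1[ -> is_cderive x (@beta R)
  ((4 * (x * (1 - x)))^-1%:C * ((1 - 2 * x)%:C * beta x - alpha x)).
Proof.
move=> x01; apply: is_cderive_eq (is_cderive_conj (is_cderive_alpha x01)) _.
have conj_lin (r s : R) (a b : C) :
    (r%:C * (s%:C * a - b))^* = r%:C * (s%:C * a^* - b^*).
  by case: a b => [a1 a2] [b1 b2]; apply/eqP; rewrite eq_complex /=;
    apply/andP; split; apply/eqP; ring.
have betaJ : (beta x)^* = alpha x by rewrite /beta; case: (alpha x) => a b /=; rewrite opprK.
apply: (etrans (conj_lin (4 * (x * (1 - x)))^-1 (1 - 2 * x) (alpha x) (beta x))).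
by congr (_ * (_ - _)); exact: betaJ.
Qed.

Lemma is_pderive_gen L n x : (n <= L)%N -> x \in `]0, 1[ ->
  let G m := gen L (alpha x) (beta x) m in
  is_pderive x (fun y => gen L (alpha y) (beta y) n)
    ((4 * (x * (1 - x)))^-1%:C%:P *
      ((1 - 2 * x)%:C%:P * (L%:R * G n) - (n%:R * G n.-1 + (L - n)%:R * G n.+1))).
Proof.
move=> nL x01 G.
have da := is_cderive_alpha x01; have db := is_cderive_beta x01.
have dp := is_pderiveX n (is_pderive_linear da db).
have dq := is_pderiveX (L - n) (is_pderive_linear db da).
apply: is_pderive_eq (is_pderiveM dp dq) _.
rewrite -[RHS](gen_derivation _ _ _ _ nL) !polyCM !polyCB !polyCM /genp /genq.
move: (_ ^+ n.-1) (_ ^+ n) (_ ^+ (L - n).-1) (_ ^+ (L - n)) => p q r s.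
move: (_%:R) ((L - n)%:R) => k l; ring.
Qed.

Lemma is_mderive_Psi0 L x : x \in `]0, 1[ ->
  is_mderive x (Psi0 L) ((4 * (x * (1 - x)))^-1%:C *:
    ((L%:R * (1 - 2 * x)%:C) *: Psi0 L x - Jmx _ L *m Psi0 L x)).
Proof.
move=> x01; have x01' := itv01W x01.
rewrite Psi0E // => n m.
have nearE : \near x, Psimx L (alpha x) (beta x) n m = Psi0 L x n m.
  near=> y; rewrite Psi0E //.
  have : y \in `]0, 1[ by near: y; exact: near_in_itvoo.
  by rewrite in_itv /= => /andP[/ltW -> /ltW ->].
suff [d1 d2] : is_cderive x (fun y => Psimx L (alpha y) (beta y) n m)
    (((4 * (x * (1 - x)))^-1%:C *: ((L%:R * (1 - 2 * x)%:C) *: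
      Psimx L (alpha x) (beta x) - Jmx _ L *m Psimx L (alpha x) (beta x))) n m).
  split.
    by apply: near_eq_is_derive d1; apply: filterS nearE => y ->.
  by apply: near_eq_is_derive d2; apply: filterS nearE => y ->.
have mE (A B : 'M[C]_L.+1) (r s : C) :
    (r *: (s *: A - B)) n m = r * (s * A n m - B n m) by rewrite !mxE.
rewrite mE mul_JPsiE; under eq_fun do rewrite mxE /psi.
have := is_cderiveM (is_pderive_gen (leq_ord n) x01 m)
  (is_cderive_cst x ('C(L, m)%:R^-1 : C)).
move=> d; apply: is_cderive_eq d _; rewrite mulr0 addr0 mxE /psi.
rewrite coefCM coefB coefCM coefD !(mulr_natl (gen _ _ _ _)) !coefMn.
move: (_^-1) => k; ring.
Unshelve. all: by end_near.
Qed.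

End PolyDerivative.

(** * The scalar weight and smoothness *)

Section ScalarWeight.
Variables (R : realType) (a : R).
Hypothesis a_gt0 : 0 < a.
Implicit Type x : R.

Lemma is_derive_continuous (f : R -> R) x d : is_derive x 1 f d ->
  {for x, continuous f}.
Proof. by case=> df _; apply/differentiable_continuous/derivable1_diffP. Qed.

Lemma is_derive_powR x : 0 < x ->
  is_derive x 1 (fun y => y `^ a) (a / x * x `^ a).
Proof.
move=> x0; apply: is_derive_eq (is_derive1_powR a x0) _.
rewrite -[in RHS](mulr_powRB1 (ltW x0) a_gt0); field.
by rewrite gt_eqF.
Qed.

Lemma is_derive_onem_powR x : x < 1 ->
  is_derive x 1 (fun y => (1 - y) `^ a) (- (a / (1 - x)) * (1 - x) `^ a).
Proof.
rewrite -subr_gt0 => x1.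
have := @is_derive1_comp _ (fun y => y `^ a) (fun y => 1 - y) _ _ _
  (is_derive_powR x1) (is_derive_onem x).
by rewrite mulrN1 mulNr.
Qed.

Lemma cont01_powR : cont01 (fun y : R => y `^ a).
Proof.
apply/(continuous_within_itvP _ (@ltr01 R)); split.
- move=> x; rewrite in_itv /= => /andP[x0 _].
  exact: is_derive_continuous (is_derive_powR x0).
- by rewrite powR0 ?gt_eqF //; exact: powR_cvg0.
- apply: cvg_at_left_filter.
  exact: (is_derive_continuous (is_derive_powR (@ltr01 R))).
Qed.

Lemma cont01_onem_powR : cont01 (fun y : R => (1 - y) `^ a).
Proof.
apply/(continuous_within_itvP _ (@ltr01 R)); split.
- move=> x; rewrite in_itv /= => /andP[_ x1].
  exact: is_derive_continuous (is_derive_onem_powR x1).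
- apply: cvg_at_right_filter.
  exact: (is_derive_continuous (is_derive_onem_powR (@ltr01 R))).
- apply: (@decreasing_cvg_at_left_comp _ (fun y => 1 - y) (fun y => y `^ a)
    (BLeft 0) 1).
  + by rewrite bnd_simp.
  + by move=> x y _ _ xy; rewrite ltrD2l ltrN2.
  + by apply: cvgB; [exact: cvg_cst | exact: cvg_at_left_filter cvg_id].
  + by rewrite subrr powR0 ?gt_eqF //; exact: powR_cvg0.
Qed.

Definition weight (y : R) := (1 - y) `^ a * y `^ a.

Lemma cont01_weight : cont01 weight.
Proof. exact: cont01M cont01_onem_powR cont01_powR. Qed.

Lemma weight0 : weight 0 = 0.
Proof. by rewrite /weight powR0 ?gt_eqF ?mulr0. Qed.

Lemma weight1 : weight 1 = 0.
Proof. by rewrite /weight subrr powR0 ?gt_eqF ?mul0r. Qed.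

(** Kept in logarithmic form, so that the derivative of [Wnu] is again expressed through [Wnu]. *)
Lemma is_derive_weight x : x \in `]0, 1[ ->
  is_derive x 1 weight (a * (1 - 2 * x) / (x * (1 - x)) * weight x).
Proof.
rewrite in_itv /= => /andP[x0 x1].
apply: is_derive_eq (is_deriveM (is_derive_onem_powR x1) (is_derive_powR x0)) _.
rewrite /GRing.scale /= /weight; move: (x `^ a) ((1 - x) `^ a) => u v; field.
by rewrite subr_eq0 !gt_eqF.
Qed.

End ScalarWeight.

(** * Smoothness on the open interval *)

Section Smoothness.
Variable R : realType.
Implicit Types (f g : R -> R) (k : nat).

(** Derivatives are given by witnesses instead of [derive1n]: sums, products, inverses and solutions
    of the differential equation are then handled by induction on [k]. *)
Fixpoint Ck k f : Prop :=
  if k is k'.+1 then exists f', Ck k' f' /\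
    forall x : R, x \in `]0, 1[ -> is_derive x 1 f (f' x)
  else True.

Lemma CkS k f : Ck k.+1 f -> Ck k f.
Proof.
elim: k f => [//|k IHk] f [f' [/IHk Cf' ff']].
by exists f'.
Qed.

Lemma Ck_eq k f g : (forall x : R, x \in `]0, 1[ -> f x = g x) -> Ck k f -> Ck k g.
Proof.
case: k => [//|k] fg [f' [Cf' ff']]; exists f'; split => // x x01.
apply: near_eq_is_derive (ff' x x01); near=> y; apply: fg.
by near: y; exact: near_in_itvoo.
Unshelve. all: by end_near.
Qed.

Lemma Ck_cst k (a : R) : Ck k (fun=> a).
Proof.
elim: k a => [//|k IHk] a; exists (fun=> 0); split => // x _.
exact: is_derive_cst.
Qed.

Lemma CkD k f g : Ck k f -> Ck k g -> Ck k (fun y => f y + g y).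
Proof.
elim: k f g => [//|k IHk] f g [f' [Cf' ff']] [g' [Cg' gg']].
exists (fun y => f' y + g' y); split; first exact: IHk.
by move=> x x01; exact: is_deriveD (ff' x x01) (gg' x x01).
Qed.

Lemma CkM k f g : Ck k f -> Ck k g -> Ck k (fun y => f y * g y).
Proof.
elim: k f g => [//|k IHk] f g Cf Cg.
have [f' [Cf' ff']] := Cf; have [g' [Cg' gg']] := Cg.
exists (fun y => f y * g' y + g y * f' y); split.
  by apply: CkD; apply: IHk => //; exact: CkS.
by move=> x x01; exact: is_deriveM (ff' x x01) (gg' x x01).
Qed.

Lemma Ck_id k : Ck k (fun y => y).
Proof.
case: k => [//|k]; exists (fun=> 1); split; first exact: Ck_cst.
by move=> x _; exact: is_derive_id.
Qed.

Lemma Ck_inv k f : (forall x : R, x \in `]0, 1[ -> f x != 0) ->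
  Ck k f -> Ck k (fun y => (f y)^-1).
Proof.
move=> f0; elim: k => [//|k IHk] Cf; have [f' [Cf' ff']] := Cf.
exists (fun y => - ((f y)^-1 * (f y)^-1) * f' y); split.
  apply: CkM => //; rewrite (_ : (fun y => _) =
    (fun y => -1 * ((f y)^-1 * (f y)^-1))); last first.
    by apply/funext => y; rewrite mulN1r.
  apply: CkM; first exact: Ck_cst.
  by apply: CkM; apply: IHk; exact: CkS.
move=> x x01; have := is_deriveV (f0 x x01) (ff' x x01).
by move=> d; apply: is_derive_eq d _; rewrite /GRing.scale /= -expr2 exprVn.
Qed.

Lemma Ck_smooth f : (forall k, Ck k f) -> smooth01 f.
Proof.
(* All orders [j] at once, since each further derivative uses up one order. *)
move=> Cf k; have CfE : forall j, Ck j (derive1n k f).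
  elim: k => [|k IHk] j //=.
  have [f' [Cf' ff']] := IHk j.+1.
  apply: Ck_eq Cf' => x /ff' d; rewrite derive1E.
  by rewrite derive_val.
by move=> y y01; have [f' [_ /(_ y y01)]] := CfE 1%N; case.
Qed.

Definition CCk k (f : R -> R[i]) :=
  Ck k (fun y => complex.Re (f y)) /\ Ck k (fun y => complex.Im (f y)).

Lemma CCkS k (f f' : R -> R[i]) : CCk k f' ->
  (forall x : R, x \in `]0, 1[ -> is_cderive x f (f' x)) -> CCk k.+1 f.
Proof.
move=> [C1 C2] df; split.
  by exists (fun y => complex.Re (f' y)); split => // x /df [].
by exists (fun y => complex.Im (f' y)); split => // x /df [].
Qed.

Lemma CCk_cst k (z : R[i]) : CCk k (fun=> z).
Proof. by split; exact: Ck_cst. Qed.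

Lemma CCkD k (f g : R -> R[i]) : CCk k f -> CCk k g ->
  CCk k (fun y => f y + g y).
Proof.
move=> [f1 f2] [g1 g2]; split.
  by under eq_fun do rewrite cReD; exact: CkD.
by under eq_fun do rewrite cImD; exact: CkD.
Qed.

Lemma CCkM k (f g : R -> R[i]) : CCk k f -> CCk k g ->
  CCk k (fun y => f y * g y).
Proof.
move=> [f1 f2] [g1 g2]; split.
  under eq_fun do rewrite cReM -mulN1r.
  by apply: CkD; [exact: CkM | apply: CkM; [exact: Ck_cst | exact: CkM]].
by under eq_fun do rewrite cImM; apply: CkD; exact: CkM.
Qed.

Lemma CCkN k (f : R -> R[i]) : CCk k f -> CCk k (fun y => - f y).
Proof.
by move=> Cf; under eq_fun do rewrite -mulN1r; apply: CCkM => //; exact: CCk_cst.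
Qed.

Lemma CCk_sum k (I : Type) (r : seq I) (f : I -> R -> R[i]) :
  (forall i, CCk k (f i)) -> CCk k (fun y => \sum_(i <- r) f i y).
Proof.
move=> Cf; elim: r => [|i r IHr].
  by under eq_fun do rewrite big_nil; exact: CCk_cst.
by under eq_fun do rewrite big_cons; exact: CCkD.
Qed.

End Smoothness.

(** * The coefficients of T and the commutator identity *)

Section RealScalars.
Variable R : realType.
Implicit Types a b : R.

Lemma realCM a b : (a * b)%:C = a%:C * b%:C :> R[i].
Proof. exact: rmorphM. Qed.

Lemma realCD a b : (a + b)%:C = a%:C + b%:C :> R[i].
Proof. exact: rmorphD. Qed.

Lemma realCN a : (- a)%:C = - a%:C :> R[i].
Proof. exact: rmorphN. Qed.

Lemma realC_nat k : (k%:R : R)%:C = k%:R :> R[i].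
Proof. exact: rmorph_nat. Qed.

Lemma realC1 : (1 : R)%:C = 1 :> R[i].
Proof. by []. Qed.

Lemma realCV a : a^-1%:C = a%:C^-1 :> R[i].
Proof. exact: fmorphV. Qed.

Lemma realCJ a : Num.conj (a%:C : R[i]) = a%:C.
Proof. exact: conjc_real. Qed.

Lemma realC_gt0 a : (0 < (a%:C : R[i])) = (0 < a).
Proof. exact: (ltcR 0 a). Qed.

Lemma realC_ge0 a : (0 <= (a%:C : R[i])) = (0 <= a).
Proof. exact: (lecR 0 a). Qed.

End RealScalars.

Section Coefficients.
Variables (R : realType) (L : nat) (nu : R).
Hypothesis hnu : 1 <= nu.

Lemma poch_add (b : R) m n : poch b (m + n) = poch b m * poch (b + m%:R) n.
Proof.
rewrite /poch big_split_ord /=; congr (_ * _).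
by apply: eq_bigr => k _; rewrite natrD addrA.
Qed.

Lemma poch_gt0 n : 0 < poch nu n.
Proof. by apply: prodr_gt0 => k _; rewrite ltr_wpDr ?ler0n // (lt_le_trans ltr01). Qed.

Lemma pochS (b : R) n : poch b n.+1 = poch b n * (b + n%:R).
Proof. by rewrite /poch big_ord_recr. Qed.

(** From (nu)_L = (nu)_(L-i) (nu + L - i)_i. The result is visibly symmetric under i -> L - i, so
    the case split in [Tmx] disappears and one recursion serves the whole range. *)
Lemma tcoefE i : (i <= L)%N ->
  tcoef L nu i = 'C(L, i)%:R * (poch nu i * poch nu (L - i) / poch nu L).
Proof.
move=> iL; rewrite /tcoef; congr (_ * _).
have -> : poch nu L = poch nu (L - i) * poch (nu + L%:R - i%:R) i.
  by rewrite -{1}(subnK iL) poch_add natrB // addrA.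
have := poch_gt0 (L - i); move: (poch nu (L - i)) => p p0.
by rewrite invfM mulrA mulfK ?gt_eqF.
Qed.

Lemma tcoef_sym i : (i <= L)%N -> tcoef L nu (L - i) = tcoef L nu i.
Proof.
by move=> iL; rewrite !tcoefE ?leq_subr // subKn // bin_sub // (mulrC (poch nu i)).
Qed.

Lemma tcoef_gt0 i : (i <= L)%N -> 0 < tcoef L nu i.
Proof.
move=> iL; rewrite tcoefE // mulr_gt0 ?ltr0n ?bin_gt0 //.
by rewrite divr_gt0 ?mulr_gt0 ?poch_gt0.
Qed.

Lemma tcoef_rec n : (n < L)%N ->
  n.+1%:R * tcoef L nu n.+1 * (nu + (L - n)%:R - 1) =
  (L - n)%:R * tcoef L nu n * (nu + n%:R).
Proof.
move=> nL; rewrite (tcoefE nL) (tcoefE (ltnW nL)) (mulrA n.+1%:R) -natrM.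
by rewrite mul_bin_left natrM pochS -(subnSK nL) (pochS _ (_ - _)) -natr1; ring.
Qed.

Definition tC i : R[i] := (tcoef L nu i)%:C.

Lemma TmxE : Tmx L nu = diag_mx (\row_(i < L.+1) tC i).
Proof.
congr diag_mx; apply/rowP => i; rewrite !mxE /tC; case: ifP => // _.
by rewrite tcoef_sym // leq_ord.
Qed.

Lemma tC_rec n : (n < L)%N ->
  n.+1%:R * tC n.+1 * (nu%:C + (L - n)%:R - 1) =
  (L - n)%:R * tC n * (nu%:C + n%:R).
Proof.
move=> nL; move: (tcoef_rec nL); rewrite /tC.
move: (tcoef L nu n) (tcoef L nu n.+1) => p q /(congr1 (fun r : R => r%:C)).
by rewrite !(realCM, realCD, realCN, realC_nat, realC1).
Qed.

End Coefficients.

(** * From the identity for T to commutators with Psi T Psi^* *)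

Section RealMatrices.
Variables (C : numClosedFieldType) (L : nat).

Lemma Emx_adj : (Emx C L) ^t* = (Emx C L)^T.
Proof. by apply/matrixP => i j; rewrite !mxE rmorphM !rmorph_nat. Qed.

Lemma Fmx_adj : (Fmx C L) ^t* = (Fmx C L)^T.
Proof. by apply/matrixP => i j; rewrite !mxE rmorphM !rmorph_nat. Qed.

Lemma Hmx_adj : (Hmx C L) ^t* = Hmx C L.
Proof.
apply/matrixP => i j; rewrite !mxE eq_sym rmorphMn rmorphB !rmorph_nat.
by case: eqP => [->|].
Qed.

(* [J Psi = Psi X] and [z H Psi = Psi M] turn both sides into
   [Psi (skew _) Psi^*], and [weight_identity] compares the middle factors. *)
Lemma commutator_identity (t : nat -> C) (nu c z : C) (P : 'M[C]_L.+1) :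
  let J := Jmx C L in let H := Hmx C L in
  let X := Emx C L + Fmx C L in let M := Emx C L - Fmx C L - c *: Hmx C L in
  let V := P *m diag_mx (\row_(i < L.+1) t i) *m P ^t* in
  (forall n, (n < L)%N ->
    n.+1%:R * t n.+1 * (nu + (L - n)%:R - 1) = (L - n)%:R * t n * (nu + n%:R)) ->
  Num.conj c = c -> Num.conj (z ^+ 2) = z ^+ 2 ->
  J *m P = P *m X -> z *: (H *m P) = P *m M ->
  (c * (4 * nu - 2 + 2 * L%:R)) *: (J *m V - V *m J ^t*) -
    (J *m (J *m V) - V *m J ^t* *m J ^t*) =
  - z ^+ 2 *: (H *m H *m V - V *m (H *m H)).
Proof.
move=> J H X M V trec cR z2R JP HP.
have VE : V = P *m diag_mx (\row_(i < L.+1) t i) *m P ^t* by [].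
have skewP A Y : A *m P = P *m Y -> Y ^t* = Y^T ->
    A *m V - V *m A ^t* = P *m skew t Y *m P ^t*.
  move=> AP Yr; have AP' : P ^t* *m A ^t* = Y^T *m P ^t*.
    by rewrite -adjmxM AP adjmxM Yr.
  by rewrite /skew mulmxBr mulmxBl VE -!mulmxA AP' !mulmxA AP.
have Xr : X ^t* = X^T.
  by rewrite /X adjmxD Emx_adj Fmx_adj -linearD.
have Mr : M ^t* = M^T.
  have trH : (c *: H)^T = c *: H by rewrite linearZ /= /H /Hmx tr_diag_mx.
  by rewrite /M !adjmxB adjmxZ cR Emx_adj Fmx_adj Hmx_adj !linearB /= trH.
have XXr : (X *m X) ^t* = (X *m X)^T by rewrite adjmxM Xr trmx_mul.
have MMr : (M *m M) ^t* = (M *m M)^T by rewrite adjmxM Mr trmx_mul.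
have JJP : J *m J *m P = P *m (X *m X) by rewrite -mulmxA JP !mulmxA JP.
(* H is applied twice before any adjoint is taken, because z^2 is real by hypothesis while z need
   not be. *)
have HHP : (z ^+ 2 *: (H *m H)) *m P = P *m (M *m M).
  rewrite -scalemxAl -mulmxA expr2 -scalerA scalemxAr HP mulmxA.
  by rewrite scalemxAl HP mulmxA.
have e1 := skewP _ _ JP Xr; have e2 := skewP _ _ JJP XXr.
have e3 := skewP _ _ HHP MMr.
rewrite adjmxM (mulmxA V) in e2.
rewrite adjmxZ z2R adjmxM Hmx_adj -scalemxAl -scalemxAr -scalerBr in e3.
have wid : c *: skew t ((4 * nu - 2 + 2 * L%:R) *: X) - skew t (X *m X) =
  - skew t (M *m M) by exact: weight_identity.
rewrite mulmxA e1 e2 scaleNr e3.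
transitivity (P *m (- skew t (M *m M)) *m P ^t*); last by rewrite mulmxN mulNmx.
rewrite -wid.
rewrite skewZ scalerA; move: (skew t X) (skew t (X *m X)) => S S2.
by rewrite mulmxBr mulmxBl scalemxAl scalemxAr.
Qed.

End RealMatrices.

(** * The differential equation for W *)

Section WeightDerivative.
Variables (R : realType) (L : nat) (nu : R).
Hypothesis hnu : 1 <= nu.
Local Notation C := R[i].
Local Notation M := 'M[C]_L.+1.
Local Notation J := (Jmx C L).
Local Notation T := (Tmx L nu).
Local Notation W := (@Wnu R L nu).
Local Notation c x := (1 - 2 * x).
Local Notation phi x := (x * (1 - x)).
Implicit Type x : R.

Let a := nu - 1 / 2.

Let a_gt0 : 0 < a.
Proof. by move: hnu; rewrite /a => ?; lra. Qed.

Definition core x : M := Psi0 L x *m T *m (Psi0 L x) ^t*.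

Lemma WnuE x : W x = (weight a x)%:C *: core x.
Proof. by []. Qed.

Lemma is_mderive_core x : x \in `]0, 1[ ->
  is_mderive x core ((4 * phi x)^-1%:C *: ((2 * L%:R * (c x)%:C) *: core x
    - (J *m core x + core x *m J ^t*))).
Proof.
move=> x01; have dP := is_mderive_Psi0 (L := L) x01.
apply: is_mderive_eq (is_mderiveM (is_mderiveMr T dP) (is_mderive_adj dP)) _.
have sJ : Num.conj (L%:R * (c x)%:C : C) = L%:R * (c x)%:C.
  by rewrite rmorphM rmorph_nat; congr (_ * _); exact: realCJ.
have -> : 2 * L%:R * (c x)%:C = L%:R * (c x)%:C + L%:R * (c x)%:C :> C by ring.
rewrite adjmxZ realCJ adjmxB adjmxZ sJ adjmxM /core.
move: (Psi0 L x) (_ ^-1%:C) (L%:R * (c x)%:C) => P r s.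
rewrite -!(scalemxAl, scalemxAr) !(mulmxBl, mulmxBr) -!(scalemxAl, scalemxAr).
by rewrite !mulmxA -scalerDr scalerDl opprD addrACA.
Qed.

(** The scalar weight adds (nu - 1/2) c / phi = (4 nu - 2) c / (4 phi) to the logarithmic part of
    the derivative of [core]. *)
Lemma is_mderive_Wnu x : x \in `]0, 1[ ->
  is_mderive x W ((4 * phi x)^-1%:C *: (((4 * nu - 2 + 2 * L%:R) * c x)%:C *: W x
    - (J *m W x + W x *m J ^t*))).
Proof.
move=> x01; have dw := is_cderive_real (is_derive_weight a_gt0 x01).
apply: is_mderive_eq (is_mderiveZ dw (is_mderive_core x01)) _.
have x0 : phi x != 0 by rewrite gt_eqF // itv01_gt0.
have -> : (a * c x / phi x * weight a x)%:C =
    (4 * phi x)^-1%:C * (4 * nu - 2)%:C * (c x)%:C * (weight a x)%:C :> C.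
  rewrite -!realCM; congr (_ %:C); rewrite /a; field.
  by move: x0; rewrite mulf_eq0 negb_or andbC.
rewrite WnuE -scalemxAr -scalemxAl.
have -> : ((4 * nu - 2 + 2 * L%:R) * c x)%:C =
    (4 * nu - 2)%:C * (c x)%:C + 2 * L%:R * (c x)%:C :> C.
  by rewrite realCM realCD (realCM 2) !realC_nat mulrDl.
move: (core x) (J *m core x) (core x *m J ^t*) => V A B.
move: (weight a x)%:C (_ ^-1%:C) (4 * nu - 2)%:C (c x)%:C => w r n d.
by apply/matrixP => i j; rewrite !mxE; ring.
Qed.

(** With alpha = e^(it/2) and c = cos t, the witness is z = i sin t; the two relations read cos t -
    e^(-it) = i sin t and e^(it) - cos t = i sin t. *)
Lemma alpha_rel x : x \in `]0, 1[ -> exists2 z : C, z ^+ 2 = - (4 * phi x)%:C &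
  (c x)%:C * alpha x - beta x = z * alpha x /\
  alpha x - (c x)%:C * beta x = z * beta x.
Proof.
rewrite in_itv /= => /andP[x0 x1]; have y0 : 0 < 1 - x by rewrite subr_gt0.
have ex : Num.sqrt x ^+ 2 = x by rewrite sqr_sqrtr // ltW.
have ey : Num.sqrt (1 - x) ^+ 2 = 1 - x by rewrite sqr_sqrtr // ltW.
exists (0 +i* (2 * Num.sqrt x * Num.sqrt (1 - x))); rewrite /beta /alpha.
  rewrite (_ : phi x = Num.sqrt x ^+ 2 * Num.sqrt (1 - x) ^+ 2); last by rewrite ex ey.
  by apply/eqP; rewrite eq_complex /=; apply/andP; split; apply/eqP; ring.
have e1 : 1 - 2 * x = 1 - 2 * Num.sqrt x ^+ 2 by rewrite ex.
have e2 : 1 - 2 * x = 2 * Num.sqrt (1 - x) ^+ 2 - 1 by rewrite ey; ring.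
move: (Num.sqrt x) (Num.sqrt (1 - x)) e1 e2 => q p e1 e2.
split; apply/eqP; rewrite eq_complex /=; apply/andP; split; apply/eqP.
- by rewrite e1; ring.
- by rewrite e2; ring.
- by rewrite e1; ring.
- by rewrite e2; ring.
Qed.

Lemma mxeval_const (A : M) x : mxeval A%:P x = A.
Proof. exact: hornerC. Qed.

Lemma mxeval_X x : mxeval 'X x = (x%:C)%:M :> M.
Proof. exact: hornerX. Qed.

Lemma mxevalN (P : {poly M}) x : mxeval (- P) x = - mxeval P x.
Proof. exact: hornerN. Qed.

Local Notation D := (@Dnu R L nu).

Lemma dcoef2E x : mxeval (dcoef2 D) x = ((phi x)%:C)%:M.
Proof.
rewrite mxevalM mxeval_X mxevalD mxevalN mxeval_X -(polyC1 M) mxeval_const.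
by rewrite mul_scalar_mx -(raddfB (@scalar_mx C L.+1)) scale_scalar_mx realCM realCD realCN.
Qed.

(** Since C = (L + 3 - J)/2, the scalar part is (2 nu + 1 + L)/2 - x (2 nu + 1 + L), a multiple of 1
    - 2x. *)
Lemma dcoef1E x : mxeval (dcoef1 D) x =
  (((2 * nu + 1 + L%:R) / 2 * c x)%:C)%:M - 2^-1 *: J.
Proof.
rewrite /= mxevalD mxevalN mxevalM mxeval_X !mxeval_const mul_scalar_mx.
have CmxE i j : Cmx R L i j = - ((L%:R - i%:R) / 2) * (j == i.+1 :> nat)%:R
    + (L%:R + 3) / 2 * (j == i)%:R - i%:R / 2 * (i == j.+1 :> nat)%:R by rewrite mxE.
have JE i j : J i j = (i == j.+1 :> nat)%:R * i%:R + (j == i.+1 :> nat)%:R * (L - i)%:R.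
  by rewrite mxE.
rewrite /Umx; move: (Cmx R L) J CmxE JE => A B AE BE.
apply/matrixP => i j; rewrite !(mxDE, mxNE, mxZE, scalar_mxE) AE BE.
rewrite !(realCM, realCD, realCN, realCV, realC_nat, realC1).
rewrite natrB ?leq_ord // (eq_sym i j) mulr_natr.
move: (j == i) (j == i.+1 :> nat) (i == j.+1 :> nat) => b1 b2 b3.
by case: b1; case: b2; case: b3; rewrite /= ?mulr1n ?mulr0n; field.
Qed.

Lemma dcoef0E x : mxeval (dcoef0 D) x =
  ((L%:R ^+ 2 / 4 - (nu - 1) * (nu + 1 + L%:R))%:C)%:M - 4^-1 *: (Hmx C L *m Hmx C L).
Proof.
rewrite /= mxevalN mxeval_const; apply/matrixP => i j.
rewrite !(mxDE, mxNE, mxZE) /Umx !scalar_mxE.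
have -> : diag_mx (\row_(k < L.+1) (k%:R * (L%:R - k%:R) : C)) i j =
    (i%:R * (L%:R - i%:R)) *+ (i == j) by rewrite !mxE.
have -> : (Hmx C L *m Hmx C L) i j = (i%:R - (L - i)%:R) ^+ 2 *+ (i == j).
  by rewrite mul_diag_mx !mxE mulrnAr.
rewrite !(realCM, realCD, realCN, realCV, realC_nat, realC1).
rewrite natrB ?leq_ord //.
by case: (i == j); rewrite /= ?mulr1n ?mulr0n; field.
Qed.

Lemma real_scalar_adj (b : R) : ((b%:C)%:M : M) ^t* = (b%:C)%:M.
Proof.
apply/matrixP => i j; rewrite !mxE eq_sym; case: eqP => _ /=.
  exact: realCJ.
exact: conjc0.
Qed.

(** The factor phi clears the denominator of W', and phi' = c raises 4 nu - 2 + 2L to 4 nu + 2 + 2L,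
    which is four times the constant (2 nu + 1 + L)/2 of F1. *)
Lemma is_mderive_dcoef2W x : x \in `]0, 1[ ->
  is_mderive x (fun y => mxeval (dcoef2 D) y *m W y)
    (2^-1 *: (mxeval (dcoef1 D) x *m W x + W x *m (mxeval (dcoef1 D) x) ^t*)).
Proof.
move=> x01; under eq_fun do rewrite dcoef2E mul_scalar_mx.
have dphi : is_derive x 1 (fun y => phi y) (c x).
  apply: is_derive_eq (is_deriveM (is_derive_id x 1) (is_derive_onem x)) _.
  by rewrite /GRing.scale /=; ring.
apply: is_mderive_eq (is_mderiveZ (is_cderive_real dphi) (is_mderive_Wnu x01)) _.
have x0 : phi x != 0 by rewrite gt_eqF // itv01_gt0.
have half : Num.conj (2^-1 : C) = 2^-1 by rewrite fmorphV rmorph_nat.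
rewrite dcoef1E adjmxB adjmxZ half real_scalar_adj mulmxBl mulmxBr.
move: (W x) => V; rewrite -!(scalemxAl, scalemxAr) mul_scalar_mx mul_mx_scalar.
rewrite scalerA -realCM.
rewrite (_ : phi x * (4 * phi x)^-1 = 4^-1); last first.
  by field; move: x0; rewrite mulf_eq0 negb_or andbC.
move: (J *m V) (V *m J ^t*) => A B; apply/matrixP => i j.
rewrite !(mxDE, mxNE, mxZE) !(realCM, realCD, realCN, realCV, realC_nat, realC1).
by field.
Qed.

(** The real scalar part of F1 commutes with [V] and is its own adjoint, so it drops out. The same
    happens for F0 below, where only H H survives. *)
Lemma dcoef1_skew (V : M) x :
  2^-1 *: (mxeval (dcoef1 D) x *m V - V *m (mxeval (dcoef1 D) x) ^t*) =
  - 4^-1 *: (J *m V - V *m J ^t*).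
Proof.
have half : Num.conj (2^-1 : C) = 2^-1 by rewrite fmorphV rmorph_nat.
rewrite dcoef1E adjmxB adjmxZ half real_scalar_adj mulmxBl mulmxBr.
rewrite -!(scalemxAl, scalemxAr) mul_scalar_mx mul_mx_scalar.
move: (J *m V) (V *m J ^t*) (_%:C) => A B b; apply/matrixP => i j.
by rewrite !(mxDE, mxNE, mxZE); field.
Qed.

Lemma dcoef0_skew (V : M) x :
  mxeval (dcoef0 D) x *m V - V *m (mxeval (dcoef0 D) x) ^t* =
  - 4^-1 *: (Hmx C L *m Hmx C L *m V - V *m (Hmx C L *m Hmx C L)).
Proof.
have quarter : Num.conj (4^-1 : C) = 4^-1 by rewrite fmorphV rmorph_nat.
rewrite dcoef0E adjmxB adjmxZ quarter real_scalar_adj adjmxM Hmx_adj.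
rewrite mulmxBl mulmxBr mul_scalar_mx mul_mx_scalar -scalemxAl -scalemxAr.
move: (Hmx C L *m Hmx C L *m V) (V *m (Hmx C L *m Hmx C L)) (_%:C) => A B b.
by apply/matrixP => i j; rewrite !(mxDE, mxNE, mxZE); ring.
Qed.

Lemma core_commutator x : x \in `]0, 1[ ->
  ((4 * nu - 2 + 2 * L%:R) * c x)%:C *: (J *m core x - core x *m J ^t*) -
    (J *m (J *m core x) - core x *m J ^t* *m J ^t*) =
  (4 * phi x)%:C *: (Hmx C L *m Hmx C L *m core x
    - core x *m (Hmx C L *m Hmx C L)).
Proof.
move=> x01; have [z z2 [r1 r2]] := alpha_rel x01.
have x01' := itv01W x01.
have z2J : Num.conj (z ^+ 2) = z ^+ 2 by rewrite z2 -realCN; exact: realCJ.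
have -> : core x = Psimx L (alpha x) (beta x) *m
    diag_mx (\row_(i < L.+1) tC L nu i) *m (Psimx L (alpha x) (beta x)) ^t*.
  by rewrite /core TmxE // (Psi0E L x01').
have -> : ((4 * nu - 2 + 2 * L%:R) * c x)%:C =
    (c x)%:C * (4 * nu%:C - 2 + 2 * L%:R) :> C.
  rewrite realCM mulrC; congr (_ * _).
  by rewrite !(realCM, realCD, realCN, realC_nat, realC1); ring.
have -> : (4 * phi x)%:C = - z ^+ 2 :> C by rewrite z2 opprK.
exact: (commutator_identity (tC_rec hnu) (realCJ (c x)) z2J
  (mul_JPsi L (alpha x) (beta x)) (mul_HPsi L r1 r2)).
Qed.

(** In the derivative of J W - W J^* the mixed terms J W J^* cancel. What remains is, up to the
    scalar weight and 1/(4 phi), the left side of [core_commutator]. *)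
Lemma is_mderive_dcoef1W x : x \in `]0, 1[ ->
  is_mderive x (fun y => 2^-1 *: (mxeval (dcoef1 D) y *m W y
      - W y *m (mxeval (dcoef1 D) y) ^t*))
    (mxeval (dcoef0 D) x *m W x - W x *m (mxeval (dcoef0 D) x) ^t*).
Proof.
move=> x01; under eq_fun do rewrite dcoef1_skew.
have dW := is_mderive_Wnu x01.
have := is_mderiveZ (is_cderive_cst x (- 4^-1 : C))
  (is_mderiveB (is_mderiveMl J dW) (is_mderiveMr (J ^t*) dW)).
move=> d; apply: is_mderive_eq d _; rewrite scale0r add0r.
rewrite (dcoef0_skew (W x) x); congr (_ *: _).
have x0 : 4 * phi x != 0 by rewrite mulf_neq0 ?pnatr_eq0 // gt_eqF // itv01_gt0.
have rp : (4 * phi x)^-1%:C * (4 * phi x)%:C = 1 :> C by rewrite -realCM mulVf.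
have := core_commutator x01; rewrite WnuE.
move: (core x) (weight a x)%:C (4 * phi x)%:C (4 * phi x)^-1%:C rp => V w p r rp.
move: (_ * c x)%:C => s e.
transitivity (w *: (Hmx C L *m Hmx C L *m V - V *m (Hmx C L *m Hmx C L)));
  last by rewrite -scalemxAr -scalemxAl scalerBr.
have -> : w *: (Hmx C L *m Hmx C L *m V - V *m (Hmx C L *m Hmx C L)) =
    (w * r) *: (p *: (Hmx C L *m Hmx C L *m V - V *m (Hmx C L *m Hmx C L))).
  by rewrite scalerA -mulrA rp mulr1.
rewrite -e -!(scalemxAl, scalemxAr) !(mulmxBr, mulmxBl, mulmxDr, mulmxDl).
rewrite -!(scalemxAl, scalemxAr) (mulmxA J V).
move: (J *m V) (V *m J ^t*) => A B.
move: (J *m A) (A *m _) (B *m _) => X1 X2 X3.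
by apply/matrixP => i j; rewrite !(mxDE, mxNE, mxZE); ring.
Qed.

End WeightDerivative.

(** * The classical pair *)

Section ComplexContinuity.
Variable R : realType.
Implicit Types f g : R -> R[i].

Lemma cont01_eq (f g : R -> R) : (forall y, 0 <= y <= 1 -> f y = g y) ->
  cont01 f -> cont01 g.
Proof.
by move=> fg; apply: subspace_eq_continuous => y; rewrite inE /= in_itv /=; exact: fg.
Qed.

Lemma mcont01_eq m n (F G : R -> 'M[R[i]]_(m, n)) :
  (forall y, 0 <= y <= 1 -> F y = G y) -> mcont01 F -> mcont01 G.
Proof.
move=> FG cF i j; have [cF1 cF2] := cF i j.
by split; [apply: cont01_eq cF1 | apply: cont01_eq cF2] => y /FG ->.
Qed.

Lemma ccont01M f g : ccont01 f -> ccont01 g -> ccont01 (fun y => f y * g y).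
Proof.
move=> [f1 f2] [g1 g2]; split.
  by under eq_fun do rewrite cReM; apply: cont01B; exact: cont01M.
by under eq_fun do rewrite cImM; apply: cont01D; exact: cont01M.
Qed.

Lemma ccont01_cst (z : R[i]) : ccont01 (fun=> z).
Proof. by split; exact: cont01_cst. Qed.

Lemma ccont01X f k : ccont01 f -> ccont01 (fun y => f y ^+ k).
Proof.
move=> cf; elim: k => [|k IHk]; first exact: (ccont01_cst 1).
by under eq_fun do rewrite exprS; exact: ccont01M.
Qed.

Lemma ccont01_sum (I : Type) (r : seq I) (f : I -> R -> R[i]) :
  (forall i, ccont01 (f i)) -> ccont01 (fun y => \sum_(i <- r) f i y).
Proof.
move=> cf; split.
  under eq_fun do rewrite cRe_sum.
  by apply: cont01_sum => i; case: (cf i).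
under eq_fun do rewrite cIm_sum.
by apply: cont01_sum => i; case: (cf i).
Qed.

Lemma ccont01_alpha : ccont01 (@alpha R).
Proof.
split; last by apply: continuous_subspaceT; exact: sqrt_continuous.
apply: continuous_subspaceT => y.
apply: (@continuous_comp _ _ _ (fun y : R => 1 - y) (@Num.sqrt R)).
  by apply: cvgB; [exact: cvg_cst | exact: cvg_id].
exact: sqrt_continuous.
Qed.

Lemma ccont01_beta : ccont01 (@beta R).
Proof.
have [a1 a2] := ccont01_alpha; split.
  by under eq_fun do rewrite cReJ.
by under eq_fun do rewrite cImJ; exact: cont01N.
Qed.

(** Continuity up to the end points is read off the square roots in alpha and beta, not off
    [acos]. *)
Lemma mcont01_Psimx L : mcont01 (fun y : R => Psimx L (alpha y) (beta y)).
Proof.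
move=> n m; under eq_fun do rewrite mxE /psi coef_gen.
apply: ccont01M; last exact: ccont01_cst.
apply: ccont01_sum => i; apply: ccont01_sum => j.
apply: ccont01M; first exact: ccont01_cst.
apply: ccont01M; first exact: ccont01_cst.
by do 2![apply: ccont01M]; apply: ccont01X;
  (exact: ccont01_alpha || exact: ccont01_beta).
Qed.

End ComplexContinuity.

Section Pair.
Variables (R : realType) (L : nat) (nu : R).
Hypothesis hnu : 1 <= nu.
Local Notation C := R[i].
Local Notation M := 'M[C]_L.+1.
Local Notation T := (Tmx L nu).
Local Notation W := (@Wnu R L nu).
Local Notation D := (@Dnu R L nu).

Let a_gt0 : 0 < nu - 1 / 2.
Proof. by move: hnu => ?; lra. Qed.

Lemma mcont01_Wnu : mcont01 W.
Proof.
pose P y := Psimx L (alpha y) (beta y) : M.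
have cP : mcont01 P := @mcont01_Psimx R L.
have cw : mcont01 (fun y => ((weight (nu - 1 / 2) y)%:C)%:M : M).
  move=> i j; under eq_fun do rewrite scalar_mxE -(mulr_natr (_%:C)).
  apply: ccont01M; last exact: ccont01_cst.
  by split; [exact: cont01_weight | exact: cont01_cst].
have cT : mcont01 (fun y => P y *m T *m (P y) ^t*).
  by apply: mcont01M (mcont01_adj cP); exact: mcont01M cP (mcont01_cst T).
apply: mcont01_eq (mcont01M cw cT) => y y01.
by rewrite WnuE /core mul_scalar_mx /P Psi0E.
Qed.

Lemma Wnu_at0 : W 0 = 0.
Proof. by rewrite WnuE weight0 // scale0r. Qed.

Lemma Wnu_at1 : W 1 = 0.
Proof. by rewrite WnuE weight1 // scale0r. Qed.

Lemma Wnu_symmetric (P Q : {poly M}) :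
  mxinner W (diff_act P D) Q = mxinner W P (diff_act Q D).
Proof.
apply: symmetry_equations.
- exact: mcont01_Wnu.
- exact: Wnu_at0.
- exact: Wnu_at1.
- by move=> x; rewrite dcoef2E real_scalar_adj scalar_mxC.
- by move=> x; exact: is_mderive_dcoef2W.
- by move=> x; exact: is_mderive_dcoef1W.
Qed.

Lemma Wnu_moments : finite_moments01 W.
Proof.
move=> k i j; have [c1 c2] := mcont01_Wnu i j.
have ck : cont01 (fun y : R => y ^+ k).
  by apply: continuous_subspaceT => y; exact: exprn_continuous.
by split; apply: cont01_integrable; exact: cont01M.
Qed.

Lemma Tmx_adj : T ^t* = T.
Proof.
rewrite TmxE //; apply/matrixP => i j; rewrite !mxE eq_sym.
case: eqP => [->|_]; first exact: realCJ.
exact: conjc0.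
Qed.

(** With u = v Psi the form is a positive scalar times the sum of t_j |u_j|^2, where every t_j is
    positive. It remains to see u != 0, which is the trivial left kernel of Psi. *)
Lemma Wnu_posdef (y : R) : y \in `]0, 1[ -> mxposdef (W y).
Proof.
move=> y01; have y01' := itv01W y01.
have w0 : 0 < weight (nu - 1 / 2) y.
  by move: y01; rewrite in_itv /= => /andP[? ?]; rewrite mulr_gt0 ?powR_gt0 ?subr_gt0.
split=> [|v v0].
  by rewrite WnuE adjmxZ realCJ /core !adjmxM adjmxK Tmx_adj mulmxA.
rewrite WnuE /core -scalemxAr -scalemxAl mxE mulr_gt0 //; first by rewrite realC_gt0.
set u := v *m Psi0 L y.
have -> : v *m (Psi0 L y *m T *m (Psi0 L y) ^t*) *m v ^t* = u *m T *m u ^t*.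
  by rewrite /u adjmxM !mulmxA.
have u0 : u != 0.
  apply: contra_neq v0 => uE.
  have [z z2 [r1 r2]] := alpha_rel y01.
  have [y0 y1] : 0 < y /\ y < 1 by apply/andP; move: y01; rewrite in_itv.
  have alpha0 : alpha y != 0.
    by rewrite eq_complex negb_and /= gt_eqF // sqrtr_gt0 subr_gt0.
  have beta0 : beta y != 0.
    by rewrite eq_complex negb_and /= gt_eqF // sqrtr_gt0 subr_gt0.
  have z0 : z != 0.
    apply: contraTneq (itv01_gt0 y01) => z0.
    have := congr1 (@complex.Re R) z2; rewrite z0 expr0n /= => /esym/eqP.
    by rewrite oppr_eq0 mulf_eq0 pnatr_eq0 => /eqP ->; rewrite ltxx.
  by apply: (Psimx_ker0 z0 alpha0 beta0 r1 r2); rewrite -Psi0E.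
clearbody u; have [k uk] : exists k, u 0 k != 0 by apply/rV0Pn.
rewrite TmxE // mul_mx_diag mxE.
have term_ge0 j : 0 <= u 0 j * tC L nu j * Num.conj (u 0 j).
  by rewrite mulrAC mulr_ge0 ?mul_conjC_ge0 // /tC realC_ge0 ltW // tcoef_gt0 // leq_ord.
under eq_bigr do rewrite !mxE.
rewrite (bigD1 k) //= ltr_pwDl ?sumr_ge0 //.
by rewrite mulrAC mulr_gt0 ?mul_conjC_gt0 // /tC realC_gt0 tcoef_gt0 // leq_ord.
Qed.

(** Bootstrapping from the linear differential equation: if the entries of [W] have k derivatives,
    then so does the right side, hence [W] has k + 1. Nothing is needed at order 0, where [Ck] is
    trivial. *)
Lemma Wnu_smooth : mxsmooth01 W.
Proof.
suff CW k i j : CCk k (fun y => W y i j).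
  by move=> i j; split; apply: Ck_smooth => k; case: (CW k i j).
elim: k i j => [|k IHk] i j; first by split.
apply: (CCkS _ (fun x x01 => is_mderive_Wnu hnu x01 i j)).
have mulE (A B : M) : (A *m B) i j = \sum_l A i l * B l j by rewrite mxE.
under eq_fun do rewrite mxZE mxDE mxNE mxZE mxDE mulE mulE.
have Conem : CCk k (fun y : R => (1 - y)%:C).
  split; last exact: Ck_cst.
  rewrite (_ : (fun y => _) = (fun y => 1 + -1 * y)).
    by apply: CkD; [exact: Ck_cst | apply: CkM; [exact: Ck_cst | exact: Ck_id]].
  by apply/funext => y; rewrite mulN1r.
apply: CCkM.
  split; last exact: Ck_cst.
  apply: Ck_inv => [x|].
    by move=> x01; rewrite mulf_neq0 ?pnatr_eq0 // gt_eqF // itv01_gt0.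
  apply: CkM; first exact: Ck_cst.
  by apply: CkM; [exact: Ck_id | case: Conem].
apply: CCkD.
  apply: CCkM => //; split; last exact: Ck_cst.
  apply: CkM; first exact: Ck_cst.
  rewrite (_ : (fun y => _) = (fun y => 1 + -2 * y)).
    by apply: CkD; [exact: Ck_cst | apply: CkM; [exact: Ck_cst | exact: Ck_id]].
  by apply/funext => y; rewrite mulNr.
apply: CCkN; apply: CCkD; apply: CCk_sum => l; apply: CCkM => //; exact: CCk_cst.
Qed.

Lemma Dnu_sizes : [/\ (size (dcoef2 D) <= 3)%N, (size (dcoef1 D) <= 2)%N &
  (size (dcoef0 D) <= 1)%N].
Proof.
have sX : (size ('X * (1 - 'X) : {poly M})%R <= 3)%N.
  apply: leq_trans (size_polyMleq _ _) _; rewrite size_polyX /=.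
  have := size_polyD (1 : {poly M}) (- 'X); rewrite size_polyN size_polyX size_poly1.
  by rewrite ltnS.
split => //.
- apply: leq_trans (size_polyD _ _) _; rewrite geq_max size_polyN.
  rewrite (leq_trans (size_polyC_leq1 _)) //=.
  apply: leq_trans (size_polyMleq _ _) _; rewrite size_polyX /=.
  by rewrite ltnS size_polyC_leq1.
- by rewrite size_polyN size_polyC_leq1.
Qed.

End Pair.

Theorem corollary3p3 (R : realType) (L : nat) (nu : R) (hnu : 1 <= nu) :
  classical_pair (@Wnu R L nu) (@Dnu R L nu).
Proof.
have [s2 s1 s0] := Dnu_sizes L nu.
split; [exact: Wnu_smooth | exact: Wnu_posdef | exact: Wnu_moments | exact: s2
  | exact: s1 | exact: s0 | exact: Wnu_symmetric].
Qed.
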